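(* There is a randomized $O(1)$-round algorithm in the Congested Clique model that, given an $n$-vertex graph $G$, with high probability finds a proper $(\kappa+O(\kappa^{3/4}\log^{1/2} n))$-coloring of $G$, where $\kappa=\kappa(G)$. For $\kappa=\omega(\log^2 n)$ this gives a $(\kappa+o(\kappa))$-coloring.
   Context: In the Congested Clique model there are $n$ nodes, each holding the incident edges of one vertex of the input graph $G$; computation proceeds in synchronous rounds in which every pair of nodes (adjacent in $G$ or not) may exchange a message of $O(\log n)$ bits; local computation and memory are unbounded. $\kappa(G)$ is the degeneracy of $G$ (least $k$ such that every induced subgraph has a vertex of degree at most $k$). High probability means at least $1-1/\mathrm{poly}(n)$.
   Formalization: The number of colors is bounded by max(1, κ+O(κ^{3/4} log^{1/2} n)) instead of κ+O(κ^{3/4} log^{1/2} n), since for an edgeless graph κ=0 and the literal bound would be 0 colors; for κ≥1 nothing changes. *)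

(* Defs.v *)
From HB Require Import structures.
From mathcomp Require Import all_boot all_order all_algebra.
From mathcomp Require Import all_classical all_reals all_analysis.

Set Implicit Arguments.
Unset Strict Implicit.
Unset Printing Implicit Defensive.

Import Order.TTheory GRing.Theory Num.Theory.
Import numFieldNormedType.Exports.

Record sgraph (n : nat) := SGraph {
  adj :> rel 'I_n;
  adj_sym : symmetric adj;
  adj_irr : irreflexive adj }.

Definition nbhd (n : nat) (G : sgraph n) (v : 'I_n) : {set 'I_n} :=
  [set u | G v u].

Definition degenerate (n : nat) (G : sgraph n) (k : nat) : bool :=
  [forall S : {set 'I_n}, (S != finset.set0) ==>
    [exists v in S, #|S :&: nbhd G v| <= k]].

Lemma degenerate_ex (n : nat) (G : sgraph n) : exists k, degenerate G k.
Proof.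
exists n; apply/forallP => S; apply/implyP => /set0Pn [v vS].
apply/existsP; exists v; rewrite vS /=.
by rewrite (leq_trans (max_card _)) ?card_ord.
Qed.

Definition degeneracy (n : nat) (G : sgraph n) : nat :=
  ex_minn (degenerate_ex G).

Definition proper_coloring (n : nat) (G : sgraph n) (k : nat)
    (col : 'I_n -> nat) : bool :=
  [forall v, col v < k] && [forall u, forall v, G u v ==> (col u != col v)].

(* A randomized algorithm for the congested clique on [n] nodes.  The node
   with identifier [v] initially knows [n], [v], the neighbourhood of the
   vertex [v] and its own string of [cc_coins] random bits.  A message is a
   string of at most [cc_bits] bits (the empty one standing for silence), and
   a node may send different messages to different nodes.  The [nat] argument
   of [cc_send] and [cc_recv] is the index of the current round. *)
Record cc_algorithm (n : nat) := CCAlgorithm {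
  cc_rounds : nat;
  cc_bits : nat;
  cc_coins : nat;
  cc_state : Type;
  cc_init : 'I_n -> {set 'I_n} -> cc_coins.-tuple bool -> cc_state;
  cc_send : nat -> 'I_n -> cc_state -> 'I_n -> cc_bits.-bseq bool;
  cc_recv : nat -> 'I_n -> cc_state -> ('I_n -> cc_bits.-bseq bool) -> cc_state;
  cc_out : 'I_n -> cc_state -> nat }.

Definition cc_seed (n : nat) (A : cc_algorithm n) : finType :=
  {ffun 'I_n -> (cc_coins A).-tuple bool}.

Fixpoint cc_run (n : nat) (A : cc_algorithm n) (G : sgraph n) (s : cc_seed A)
    (t : nat) : 'I_n -> cc_state A :=
  if t is t'.+1 then
    let st := cc_run G s t' in
    fun v => cc_recv t' v (st v) (fun u => cc_send t' u (st u) v)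
  else fun v => cc_init v (nbhd G v) (s v).

Definition cc_output (n : nat) (A : cc_algorithm n) (G : sgraph n)
    (s : cc_seed A) (v : 'I_n) : nat :=
  cc_out v (cc_run G s (cc_rounds A) v).

Local Open Scope ring_scope.

(* The seed is uniform, i.e. the nodes toss independent fair private coins. *)
Definition cc_prob (R : realType) (n : nat) (A : cc_algorithm n)
    (E : pred (cc_seed A)) : R :=
  #|[set s | E s]|%:R / #|cc_seed A|%:R.

(* With probability at least [1 - n ^ -c], [A] outputs a proper coloring of [G]
   with at most [x] colors; the palette size [k] is the same for all seeds. *)
Definition whp_colors (R : realType) (c : nat) (n : nat) (A : cc_algorithm n)
    (G : sgraph n) (x : R) : Prop :=
  exists k : nat, k%:R <= x /\
    1 - (n%:R ^+ c)^-1 <=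
      cc_prob R (fun s : cc_seed A => proper_coloring G k (cc_output G s)).

(* Main.v *)
Require Import Defs.
From HB Require Import structures.
From mathcomp Require Import all_boot all_order all_algebra.
From mathcomp Require Import all_classical all_reals all_analysis.
From mathcomp Require Import ring lra zify.

Import Order.TTheory GRing.Theory Num.Theory.
Import numFieldNormedType.Exports.

Set Implicit Arguments.
Unset Strict Implicit.
Unset Printing Implicit Defensive.

(** Orient [G] acyclically with out-degree at most [kappa] and split the
    vertices into [2 ^ j] random blocks.  A vertex keeps about [kappa / 2 ^ j]
    of its out-neighbours in its own block, so the block is greedily colorable
    with about that many colors, and for [4 ^ j] about [kappa] a block spans
    only [O(n)] edges: one leader per block can collect it by routing the edges
    through distinct relays and color it optimally.  Since [kappa] is unknown,
    the nodes announce their blocks at all levels [j] at once (prefixes of one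
    random string) and use the first level at which every block is small.

    For [kappa >= ln^2 n] a Chernoff bound and a union bound over the vertices
    give the result.  For smaller [kappa] a few vertices of each block may have
    too many out-neighbours; the budget is then [Omega(kappa)], so one can
    afford to color two exceptional sets with [kappa + 1] fresh colors each: the
    vertices of degree at least [log^4 n], and the vertices left uncolored by
    the leaders.  Among the remaining vertices the bad events have polylog
    dependency degree, so that their number is concentrated.  The algorithm runs
    both variants and keeps the one with the smaller palette. *)

(** * Knowledge in the congested clique *)

(** The error term arises as follows. At level [j] a vertex has about [kappa / 2 ^ j] out-neighbours
    in its block, with deviation [sqrt (kappa / 2 ^ j * ln n)]. Over [2 ^ j] blocks the deviations
    cost [sqrt (kappa * 2 ^ j * ln n)] colors, which is [kappa ^ (3/4) * ln n ^ (1/2)] for [2 ^ j]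
    about [sqrt kappa]. The Gaussian range of the Chernoff bound needs [ln n <= sqrt kappa], whence
    the split at [ln^2 n]. Degrees may be far above [kappa]; only out-degrees are bounded, and the
    orientation lives in the analysis alone. A leader looks for an optimal coloring, hence does at
    least as well as the greedy one, without knowing the orientation. Every node learns whether a
    run succeeded and how large its palette is. A successful run is always proper, so chance affects
    only success and palette size, and the better of the two runs can be selected without knowing
    [kappa]. *)

Definition prob (R : realType) (T : finType) (E : pred T) : R :=
  (#|[set s | E s]|%:R / #|T|%:R)%R.

Section Knowledge.
Variables (n Q b : nat).

Definition seeds : finType := {ffun 'I_n -> Q.-tuple bool}.
Definition world : Type := (sgraph n * seeds)%type.
(* [E w w' v]: node [v] cannot tell the executions on [w] and [w'] apart.  A value
   is computable at [v] iff it is invariant under this relation, so protocols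
   are described by their messages as functions of the whole world. *)
Definition indist := world -> world -> 'I_n -> Prop.
Implicit Types (E : indist) (w : world).

Definition knows E (Y : Type) (f : world -> 'I_n -> Y) :=
  forall w w' v, E w w' v -> f w v = f w' v.

(** A protocol given only by what it teaches: each round refines the indistinguishability relation
    by the messages received. A message is any function of the world that its sender knows, in any
    type that fits into [b] bits. *)
Inductive reach : nat -> indist -> Prop :=
| reach0 : reach 0 (fun w w' v => nbhd w.1 v = nbhd w'.1 v /\ w.2 v = w'.2 v)
| reachS T E (M : finType) (msg : world -> 'I_n -> 'I_n -> M) :
    reach T E -> #|M| <= 2 ^ b ->
    (forall v, knows E (fun w u => msg w u v)) ->
    reach T.+1
      (fun w w' v => E w w' v /\ forall u, msg w u v = msg w' u v).

Definition view : Type :=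
  ({set 'I_n} * Q.-tuple bool * seq ('I_n -> b.-bseq bool))%type.
Definition sender := nat -> 'I_n -> view -> 'I_n -> b.-bseq bool.
Implicit Types snd : sender.

(** Local memory is unbounded, so the state can be the whole history. *)
Definition full_info T snd (out : 'I_n -> view -> nat) : cc_algorithm n :=
  @CCAlgorithm n T b Q view (fun _ N r => (N, r, [::])) snd
    (fun _ _ st m => (st.1, rcons st.2 m)) out.

Fixpoint views snd w t : 'I_n -> view :=
  if t is t'.+1 then
    fun v => ((views snd w t' v).1,
              rcons (views snd w t' v).2
                    (fun u => snd t' u (views snd w t' u) v))
  else fun v => (nbhd w.1 v, w.2 v, [::]).

Lemma cc_run_views T snd out (G : sgraph n) (s : seeds) t :
  @cc_run n (full_info T snd out) G s t = views snd (G, s) t.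
Proof. by elim: t => //= t ->. Qed.

Lemma views_ext snd snd' w t :
  (forall i, i < t -> snd i = snd' i) -> views snd w t = views snd' w t.
Proof.
elim: t => //= t IHt eq_snd; rewrite IHt; last by move=> i /ltnW; apply: eq_snd.
by rewrite eq_snd.
Qed.

Lemma bits_encode (M : finType) : #|M| <= 2 ^ b ->
  exists enc : M -> b.-bseq bool, injective enc.
Proof.
move=> leM; have leT : #|M| <= #|{: b.-tuple bool}| by rewrite card_tuple card_bool.
exists (fun x => Bseq (eq_leq (size_tuple (enum_val (widen_ord leT (enum_rank x)))))) => x y.
move=> /(congr1 val) /= /val_inj /enum_val_inj /(congr1 val) /= /val_inj.
exact: enum_rank_inj.
Qed.

(** Passes from messages that are functions of the world to messages that are functions of the
    sender's view, as an algorithm requires. *)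
Lemma reach_views T E : reach T E ->
  exists snd, forall w w' v, views snd w T v = views snd w' T v -> E w w' v.
Proof.
elim=> {T E} [|T E M msg _ [snd IH] leM kmsg].
  by exists (fun _ _ _ _ => [bseq]) => w w' v /= [-> ->].
have [enc enc_inj] := bits_encode leM.
(* Any world producing the view [st] may be used: by [IH] and [kmsg] all of them give the same
   message. Views that never occur get a default. *)
pose new u (st : view) v : b.-bseq bool :=
  if pselect (exists w, views snd w T u = st) is left ex
  then enc (msg (projT1 (cid ex)) u v) else [bseq].
have newE w u v : new u (views snd w T u) v = enc (msg w u v).
  rewrite /new; case: pselect => [ex|[]]; last by exists w.
  by case: (cid ex) => w' /= /IH /kmsg ->.
pose snd' t := if t == T then new else snd t.
have views' w : views snd' w T = views snd w T.
  by apply: views_ext => i ltiT; rewrite /snd' ltn_eqF.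
exists snd' => w w' v /=; rewrite !views' => -[e1 e2].
have [e3 e4] := rcons_inj e2.
split=> [|u].
  by apply: IH; rewrite (surjective_pairing (views snd w T v)) e1 e3 -surjective_pairing.
move: (congr1 (fun f => f u) e4); rewrite /snd' eqxx !newE; exact: enc_inj.
Qed.

Lemma reach_realize T E (out : world -> 'I_n -> nat) :
  reach T E -> knows E out ->
  exists A : cc_algorithm n, [/\ cc_rounds A = T, cc_bits A = b &
    forall (R : realType) (G : sgraph n) (k : nat),
    cc_prob R (fun s : cc_seed A => proper_coloring G k (cc_output G s)) =
    prob R (fun s : seeds => proper_coloring G k (out (G, s)))].
Proof.
move=> /reach_views [snd sndE] kout.
pose o v (st : view) : nat :=
  if pselect (exists w, views snd w T v = st) is left ex
  then out (projT1 (cid ex)) v else 0.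
exists (full_info T snd o); split=> // R G k.
rewrite /cc_prob /prob; congr (_%:R / _)%R; apply: eq_card => s; rewrite !inE.
congr proper_coloring; apply/funext => v; rewrite /cc_output cc_run_views /=.
rewrite /o; case: pselect => [ex|[]]; last by exists (G, s).
by case: (cid ex) => w' /= /sndE /kout.
Qed.

End Knowledge.

(** * Gathering a subgraph at a leader *)

Lemma leq_expn2r a b k : a <= b -> a ^ k <= b ^ k.
Proof. by move=> leab; elim: k => // k IHk; rewrite !expnS leq_mul. Qed.

Lemma nth_map_enum_ord m (A : Type) (f : 'I_m.+1 -> A) a (v : 'I_m.+1) :
  nth a [seq f u | u <- enum 'I_m.+1] v = f v.
Proof. by rewrite (nth_map ord0) ?size_enum_ord // nth_ord_enum. Qed.

Section Routing.
Variable m : nat.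
Local Notation n := m.+1.
Implicit Types (lab : 'I_n -> 'I_n) (S : 'I_n -> {set 'I_n}).

Definition class_shape lab (d : 'I_n -> nat) (c : 'I_n) : seq nat :=
  [seq if lab v == c then d v else 0 | v <- enum 'I_n].

Definition class_lists lab S (c : 'I_n) : seq (seq 'I_n) :=
  [seq if lab v == c then enum (S v) else [::] | v <- enum 'I_n].

Definition items lab S c : seq 'I_n := flatten (class_lists lab S c).

Definition load lab S c : nat := \sum_(v | lab v == c) #|S v|.

Lemma shape_class_lists lab S c :
  shape (class_lists lab S c) = class_shape lab (fun v => #|S v|) c.
Proof.
rewrite /shape /class_lists /class_shape -map_comp; apply: eq_map => v /=.
by case: eqP => // _; rewrite -cardE.
Qed.

Lemma size_items lab S c : size (items lab S c) = load lab S c.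
Proof.
rewrite size_flatten shape_class_lists sumnE big_map big_enum /load.
by rewrite [RHS]big_mkcond.
Qed.

(* Item [t] of the array of class [c] travels through node [t %% n].  The items
   of one vertex are at most [n] consecutive ones, hence use distinct relays. *)
Definition relayed lab S (v x : 'I_n) : 'I_n :=
  let sh := class_shape lab (fun u => #|S u|) (lab v) in
  nth ord0 (enum (S v))
    (find (fun i => flatten_index sh v i %% n == x) (iota 0 #|S v|)).

(** Offsets inside the list of one vertex are below [#|S v| <= n], so at most one of them has a
    given residue, and the [find] in [relayed] hits the offset of item [t]. *)
Lemma relayed_item lab S c t
    (sh := class_shape lab (fun u => #|S u|) c)
    (v := inord (reshape_index sh t) : 'I_n) :
  t < load lab S c ->
  nth ord0 (items lab S c) t = relayed lab S v (inord (t %% n)).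
Proof.
rewrite -size_items => lt_t.
have shE : shape (class_lists lab S c) = sh := shape_class_lists lab S c.
have lt_sh : t < sumn sh by rewrite -shE -size_flatten.
have lt_r : reshape_index sh t < n.
  by have := reshape_indexP lt_sh; rewrite size_map size_enum_ord.
have vE : v = reshape_index sh t :> nat by rewrite /v inordK.
have lt_o := reshape_offsetP lt_sh; rewrite -vE nth_map_enum_ord in lt_o.
rewrite /items nth_flatten shE -vE nth_map_enum_ord.
set o := reshape_offset sh t in lt_o *.
case: eqP lt_o => // labv lt_o.
rewrite /relayed labv -/sh; congr nth.
set a := (fun _ => _).
have ao : a o.
  by rewrite /a vE reshape_indexK inordK // ltn_mod.
have has_a : has a (iota 0 #|S v|).
  by apply/hasP; exists o => //; rewrite mem_iota.
have lt_f : find a (iota 0 #|S v|) < #|S v|.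
  by move: has_a; rewrite has_find size_iota.
have := nth_find 0 has_a; rewrite nth_iota // add0n.
set f := find _ _ in lt_f *; rewrite /a => /eqP af.
move: ao; rewrite /a -af /flatten_index => /eqP.
move=> /eqP; rewrite eqn_modDl => /eqP.
have leS : #|S v| <= n by rewrite -[X in _ <= X]card_ord max_card.
by rewrite !modn_small // ?(leq_trans lt_o) ?(leq_trans lt_f).
Qed.

(** Labels and cardinalities determine the shape, and flattening is injective for a fixed shape; so
    the flat array suffices for the leader. *)
Lemma items_inj lab lab' S S' c :
  lab =1 lab' -> (forall v, #|S v| = #|S' v|) ->
  items lab S c = items lab' S' c ->
  forall v, lab v = c -> S v = S' v.
Proof.
move=> eq_lab eq_card eq_items v labv.
have eq_ss : class_lists lab S c = class_lists lab' S' c.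
  apply: eq_from_flatten_shape => //; rewrite !shape_class_lists.
  by apply: eq_map => u; rewrite eq_lab eq_card.
have := congr1 (fun s => nth [::] s v) eq_ss.
rewrite !nth_map_enum_ord -eq_lab labv eqxx => e.
by apply/setP => u; rewrite -[LHS]mem_enum e mem_enum.
Qed.

End Routing.

Section Gather.
Variables (m Q b K : nat).
Local Notation n := m.+1.
Local Notation world := (world n Q).
Local Notation indist := (indist n Q).
Local Notation reach := (@reach n Q b).

Lemma reach_bcast T (E : indist) (M : finType) (val : world -> 'I_n -> M) :
  reach T E -> #|M| <= 2 ^ b -> knows E val ->
  exists E', [/\ reach T.+1 E', (forall w w' v, E' w w' v -> E w w' v) &
    forall w w' v, E' w w' v -> val w =1 val w'].
Proof.
move=> rE leM kval.
exists (fun w w' v => E w w' v /\ forall u, val w u = val w' u); split.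
- exact: (@reachS _ _ _ _ _ _ (fun w u _ => val w u)).
- by move=> w w' v [].
- by move=> w w' v [].
Qed.

(** Three rounds: sizes are broadcast, items go to their relays, and each relay sends one batch to
    the leader of each class, which is the node named by the label. A batch holds [K] identifiers,
    whence [n ^ K <= 2 ^ b]. *)
Lemma reach_gather T (E : indist) (lab : world -> 'I_n -> 'I_n)
    (S : world -> 'I_n -> {set 'I_n}) :
  n.+1 <= 2 ^ b -> n ^ K <= 2 ^ b -> reach T E ->
  (forall w w' x, E w w' x -> lab w =1 lab w') -> knows E S ->
  exists E', [/\ reach T.+3 E', (forall w w' v, E' w w' v -> E w w' v),
    (forall w w' x, E' w w' x -> forall v, #|S w v| = #|S w' v|) &
    forall w w' c, E' w w' c -> load (lab w) (S w) c <= K * n ->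
      forall v, lab w v = c -> S w v = S w' v].
Proof.
move=> leb lebK rE klab kS.
have leS w v : #|S w v| < n.+1 by rewrite ltnS -[X in _ <= X]card_ord max_card.
have [|w w' v Ew|E1 [rE1 sub1 kcard]] :=
    @reach_bcast T E 'I_n.+1 (fun w v => Ordinal (leS w v)) rE.
- by rewrite card_ord.
- by apply: val_inj; rewrite /= (kS _ _ _ Ew).
have {}kcard w w' v : E1 w w' v -> forall u, #|S w u| = #|S w' u|.
  by move=> /kcard e u; have /(congr1 val) := e u.
have kshape w w' v c : E1 w w' v ->
    class_shape (lab w) (fun u => #|S w u|) c =
    class_shape (lab w') (fun u => #|S w' u|) c.
  move=> Ew; apply: eq_map => u; rewrite (kcard _ _ _ Ew).
  by rewrite (klab _ _ _ (sub1 _ _ _ Ew)).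
have kload w w' v c : E1 w w' v ->
    load (lab w) (S w) c = load (lab w') (S w') c.
  move=> Ew; apply: eq_big => [u|u _]; last exact: kcard Ew _.
  by rewrite (klab _ _ _ (sub1 _ _ _ Ew)).
pose E2 : indist := fun w w' x => E1 w w' x /\
  forall v, relayed (lab w) (S w) v x = relayed (lab w') (S w') v x.
have rE2 : reach T.+2 E2.
  apply: (@reachS _ _ _ _ _ _ (fun w v x => relayed (lab w) (S w) v x)) => //.
    by rewrite card_ord ltnW.
  move=> x w w' v Ew; rewrite /relayed (kS _ _ _ (sub1 _ _ _ Ew)).
  by rewrite (klab _ _ _ (sub1 _ _ _ Ew) v) (kshape _ _ _ _ Ew).
(* The items of class [c] that went through [x]. The relay knows the class shapes, hence which
   vertex sent it the item at a given position; positions beyond the load are filled with [ord0]. *)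
pose batch w (x c : 'I_n) : K.-tuple 'I_n :=
  [tuple nth ord0 (items (lab w) (S w) c) (q * n + x) | q < K].
exists (fun w w' c => E2 w w' c /\ forall x, batch w x c = batch w' x c).
split.
- apply: reachS => //.
    by rewrite card_tuple card_ord.
  move=> c w w' x [Ew rel]; apply: eq_from_tnth => q; rewrite !tnth_mktuple.
  have xE t : t = q * n + x -> inord (t %% n) = x.
    by move=> ->; rewrite modnMDl modn_small // inord_val.
  case: (ltnP (q * n + x) (load (lab w) (S w) c)) => lt_t.
    rewrite !relayed_item -?(kload _ _ _ _ Ew) // !(xE _ erefl) rel.
    by rewrite (kshape _ _ _ _ Ew).
  by rewrite !nth_default // size_items -?(kload _ _ _ _ Ew).
- by move=> w w' v [[/sub1]].
- by move=> w w' x [[/kcard]].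
move=> w w' c [[Ew _] eq_b] le_load.
apply: items_inj; [exact: klab (sub1 _ _ _ Ew) | exact: kcard Ew |].
apply: (@eq_from_nth _ ord0); first by rewrite !size_items (kload _ _ _ _ Ew).
move=> t; rewrite size_items => lt_t.
have lt_q : t %/ n < K by rewrite ltn_divLR // (leq_trans lt_t).
have := congr1 (fun u => tnth u (Ordinal lt_q)) (eq_b (inord (t %% n))).
by rewrite !tnth_mktuple /= inordK ?ltn_mod // -divn_eq.
Qed.

End Gather.

(** * The algorithm *)

Lemma inord_pair_inj n (A : Type) (a a' : nat) (o o' : A) : a <= n -> a' <= n ->
  (inord a : 'I_n.+1, o) = (inord a', o') -> a = a' /\ o = o'.
Proof.
by move=> la la' [/(congr1 val)] /=; rewrite !inordK ?ltnS // => -> ->.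
Qed.

(** * Optimal partial colorings *)

Section PartialColoring.
Variable n : nat.
Implicit Types (W Z : {set 'I_n}) (g : 'I_n -> {set 'I_n}).

(** The slack [tau] absorbs the crowded vertices: a leader cannot recognize them, since they depend
    on the orientation, but it may leave any [tau] vertices uncolored. *)
Definition partial_ok tau W g c (f : {ffun 'I_n -> option 'I_n}) : bool :=
  [&& [forall v in W, if f v is Some x then x < c else true],
      [forall v in W, forall u in g v,
        (u != v) && (f u == f v) ==> (f v == None)] &
      #|[set v in W | f v == None]| <= tau].

Lemma partial_ok_full tau W g : partial_ok tau W g n [ffun v => Some v].
Proof.
apply/and3P; split.
- by apply/forall_inP => v _; rewrite ffunE.
- apply/forall_inP => v _; apply/forall_inP => u _; rewrite !ffunE.
  by apply/implyP => /andP[/eqP uv /eqP[]].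
- rewrite (_ : [set v in W | _] = finset.set0) ?cards0 //.
  by apply/setP => v; rewrite !inE ffunE andbF.
Qed.

Lemma partial_ok_ex tau W g : exists c, [exists f, partial_ok tau W g c f].
Proof. by exists n; apply/existsP; exists [ffun v => Some v]; apply: partial_ok_full. Qed.

(* Locked, as are [label] and [level] below: conversion would otherwise try to
   evaluate the enumerations in the bodies. *)
Definition ncol_def tau W g : nat := ex_minn (partial_ok_ex tau W g).
Definition ncol tau W g : nat := locked ncol_def tau W g.

Definition pcol_def tau W g : {ffun 'I_n -> option 'I_n} :=
  odflt [ffun => None] [pick f | partial_ok tau W g (ncol tau W g) f].
Definition pcol tau W g : {ffun 'I_n -> option 'I_n} := locked pcol_def tau W g.

Lemma pcol_ok tau W g : partial_ok tau W g (ncol tau W g) (pcol tau W g).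
Proof.
rewrite /pcol -lock /pcol_def; case: pickP => // none; move: none.
rewrite /ncol -lock /ncol_def.
by case: ex_minnP => c /existsP[f okf] _ /(_ f); rewrite okf.
Qed.

Lemma ncol_le_n tau W g : ncol tau W g <= n.
Proof.
rewrite /ncol -lock /ncol_def; case: ex_minnP => c _; apply; apply/existsP.
by exists [ffun v => Some v]; apply: partial_ok_full.
Qed.

Lemma ncol_le tau W g Z c (col : 'I_n -> nat) :
  #|Z| <= tau -> (forall v, v \in W -> v \notin Z -> col v < c) ->
  (forall u v, u \in W -> v \in W -> u \notin Z -> v \notin Z -> u \in g v ->
    u != v -> col u != col v) ->
  ncol tau W g <= c.
Proof.
(* For [c >= n] the coloring by identifiers suffices; otherwise all colors fit into ['I_n]. *)
move=> leZ ltc neq; have [/(leq_trans (ncol_le_n _ _ _))//|ltcn] := leqP n c.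
rewrite /ncol -lock /ncol_def; case: ex_minnP => c' _; apply; apply/existsP.
have lt x (xW : x \in W) (xZ : x \notin Z) : col x < n.
  by rewrite (ltn_trans (ltc _ xW xZ)).
pose inn k : 'I_n := insubd (Ordinal ltcn) k.
exists [ffun v => if (v \in W) && (v \notin Z) then Some (inn (col v)) else None].
apply/and3P; split.
- apply/forall_inP => v vW; rewrite ffunE vW /=; case: ifP => // vZ.
  by rewrite insubdK ?ltc // -topredE /= lt.
- apply/forall_inP => v vW; apply/forall_inP => u ug; rewrite !ffunE vW /=.
  apply/implyP => /andP[uv]; case: ifP => [/andP[uW uZ]|_]; case: ifP => // vZ.
  move=> /eqP[/(congr1 val)] /=.
  rewrite !insubdK -?topredE /= ?lt // => e.
  by have := neq _ _ uW vW uZ vZ ug uv; rewrite e eqxx.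
- apply: leq_trans leZ; apply/subset_leq_card/fintype.subsetP => v.
  by rewrite !inE ffunE => /andP[->]; case: ifP => //= /negbFE.
Qed.

Lemma pcol_lt tau W g v x :
  v \in W -> pcol tau W g v = Some x -> x < ncol tau W g.
Proof. by have /and3P[/forall_inP h _ _] := pcol_ok tau W g => /h + e; rewrite e. Qed.

Lemma pcol_neq tau W g u v x y :
  v \in W -> u \in g v -> u != v ->
  pcol tau W g u = Some x -> pcol tau W g v = Some y -> x != y.
Proof.
have /and3P[_ /forall_inP h _] := pcol_ok tau W g => /h /forall_inP {}h /h.
by move=> + uv eu ev; rewrite eu ev uv /=; apply: contraTneq => ->; rewrite eqxx.
Qed.

Lemma pcol_card tau W g : #|[set v in W | pcol tau W g v == None]| <= tau.
Proof. by have /and3P[] := pcol_ok tau W g. Qed.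

End PartialColoring.

(** * Blocks, levels and the combined coloring *)

Section Algorithm.
Variables (m Q K : nat).
Local Notation n := m.+1.
Local Notation world := (world n Q).
Implicit Types (w : world) (D j : nat) (v u c : 'I_n).

Definition deg w v : nat := #|nbhd w.1 v|.

(* The vertices of degree at least [D] form a class of their own, with leader
   [ord_max]; the codes of the random blocks stay below [ord_max] as [2 ^ Q < n]. *)
Definition label_def D w j v : 'I_n :=
  if D <= deg w v then ord_max
  else inord (enum_rank [tuple of take j (w.2 v)]).

Definition label D w j v : 'I_n := locked label_def D w j v.

Lemma labelE D w j v : label D w j v =
  if D <= deg w v then ord_max else inord (enum_rank [tuple of take j (w.2 v)]).
Proof. by rewrite /label -lock. Qed.

Definition peers D w j v : {set 'I_n} :=
  nbhd w.1 v :&: [set u | label D w j u == label D w j v].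

Definition level_ok D w j : bool :=
  [forall c, load (label D w j) (peers D w j) c <= K * n].

(** Levels are indexed by nodes so that node [u] can test level [u], all in parallel. The value [n]
    of a failing [find] signals that no level is admissible. *)
Definition level_def D w : nat :=
  find (fun u : 'I_n => level_ok D w u) (enum 'I_n).
Definition level D w : nat := locked level_def D w.

Lemma levelE D w :
  level D w = find (fun u : 'I_n => level_ok D w u) (enum 'I_n).
Proof. by rewrite /level -lock. Qed.

Definition lab D w : 'I_n -> 'I_n := label D w (level D w).

Definition block D w c : {set 'I_n} := [set v | lab D w v == c].

Definition block_graph D w c : 'I_n -> {set 'I_n} :=
  fun v => if lab D w v == c then peers D w (level D w) v else finset.set0.

Definition block_ncol D w c : nat :=
  if level D w < n then ncol (n %/ D) (block D w c) (block_graph D w c) else 0.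

Definition block_col D w c : {ffun 'I_n -> option 'I_n} :=
  if level D w < n then pcol (n %/ D) (block D w c) (block_graph D w c)
  else [ffun => None].

Definition left_over D w v : bool := block_col D w (lab D w v) v == None.

Definition rest D w : {set 'I_n} := [set v | left_over D w v].

Definition rest_graph D w v : {set 'I_n} :=
  if left_over D w v then nbhd w.1 v :&: rest D w else finset.set0.

Definition rest_ok D w : bool := load (fun=> ord0) (rest_graph D w) ord0 <= K * n.

Definition rest_ncol D w : nat :=
  if rest_ok D w then ncol 0 (rest D w) (rest_graph D w) else 0.

Definition rest_col D w : {ffun 'I_n -> option 'I_n} :=
  if rest_ok D w then pcol 0 (rest D w) (rest_graph D w) else [ffun => None].

Definition palette D w : nat := \sum_c block_ncol D w c + rest_ncol D w.

Definition success D w : bool := (level D w < n) && rest_ok D w.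

Definition color D w v : nat :=
  if block_col D w (lab D w v) v is Some x
  then \sum_(c : 'I_n | c < lab D w v) block_ncol D w c + x
  else \sum_c block_ncol D w c + (if rest_col D w v is Some x then x else 0).

Definition better D D' w : nat :=
  if success D w && (success D' w ==> (palette D w <= palette D' w)) then D else D'.

Lemma level_okP D w : level D w < n -> level_ok D w (level D w).
Proof.
move=> ltn; have hasl : has (fun u : 'I_n => level_ok D w u) (enum 'I_n).
  by rewrite has_find size_enum_ord -levelE.
by have := nth_find ord0 hasl; rewrite -levelE nth_enum_ord.
Qed.

Lemma level_le D w j : j < n -> level_ok D w j -> level D w <= j.
Proof.
move=> ltj okj; rewrite leqNgt levelE; apply/negP => lt.
have := @before_find _ ord0 (fun u : 'I_n => level_ok D w u) (enum 'I_n) j lt.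
by rewrite nth_enum_ord // okj.
Qed.

Lemma block_ncol_le_n D w c : block_ncol D w c <= n.
Proof. by rewrite /block_ncol; case: ifP => // _; apply: ncol_le_n. Qed.

Lemma rest_ncol_le_n D w : rest_ncol D w <= n.
Proof. by rewrite /rest_ncol; case: ifP => // _; apply: ncol_le_n. Qed.

(** The blocks use consecutive disjoint intervals of colors and the left-over vertices the interval
    after them, so only edges inside one block or inside [rest] matter, and these were seen by a
    leader. *)
Lemma color_proper D w : success D w ->
  proper_coloring w.1 (palette D w) (color D w).
Proof.
case/andP => okl okr.
have offset c x : x < block_ncol D w c ->
    \sum_(c' : 'I_n | c' < c) block_ncol D w c' + x < \sum_(c' : 'I_n | c' <= c) block_ncol D w c'.
  move=> ltx; rewrite (bigD1 c (P := fun c' : 'I_n => c' <= c)) //= addnC.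
  rewrite -addSn leq_add // eq_leq //; apply: eq_bigl => c'.
  by rewrite ltn_neqAle andbC.
have mono (P P' : pred 'I_n) : subpred P P' ->
    \sum_(c | P c) block_ncol D w c <= \sum_(c | P' c) block_ncol D w c.
  move=> sPP'; rewrite !(big_mkcond P) !(big_mkcond P') leq_sum // => c _.
  by case: ifP => // /sPP' ->.
have block_lt v x : block_col D w (lab D w v) v = Some x ->
    x < block_ncol D w (lab D w v).
  by rewrite /block_col /block_ncol okl; apply: pcol_lt; rewrite inE.
have rest_some v : block_col D w (lab D w v) v = None ->
    exists2 y, rest_col D w v = Some y & y < rest_ncol D w.
  move=> e; have vr : v \in rest D w by rewrite inE /left_over e.
  rewrite /rest_col /rest_ncol okr.
  case ey: (pcol _ _ _ v) => [y|]; first by exists y => //; apply: pcol_lt ey.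
  have := pcol_card 0 (rest D w) (rest_graph D w).
  by rewrite leqn0 => /eqP/cards0_eq/setP/(_ v); rewrite !inE ey /left_over e.
have main_lt v x : block_col D w (lab D w v) v = Some x ->
    \sum_(c : 'I_n | c < lab D w v) block_ncol D w c + x < \sum_c block_ncol D w c.
  by move=> /block_lt/offset lt; apply: leq_trans lt (mono _ _ _).
apply/andP; split.
  apply/forallP => v; rewrite /color /palette.
  case e: (block_col D w (lab D w v) v) => [x|].
    exact: leq_trans (main_lt _ _ e) (leq_addr _ _).
  by have [y -> lty] := rest_some _ e; rewrite ltn_add2l.
apply/forallP => u; apply/forallP => v; apply/implyP => Guv.
have uv : u != v by apply: contraTneq Guv => ->; rewrite adj_irr.
have uNv : u \in nbhd w.1 v by rewrite inE adj_sym.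
rewrite /color; case eu: (block_col D w (lab D w u) u) => [x|];
  case ev: (block_col D w (lab D w v) v) => [y|].
- case: (ltngtP (lab D w u) (lab D w v)) => [ltl|ltl|/val_inj el].
  + rewrite ltn_eqF // (leq_trans (offset _ _ (block_lt _ _ eu))) //.
    apply: leq_trans (leq_addr _ _); apply: mono => c /= le; exact: leq_ltn_trans ltl.
  + rewrite gtn_eqF // (leq_trans (offset _ _ (block_lt _ _ ev))) //.
    apply: leq_trans (leq_addr _ _); apply: mono => c /= le; exact: leq_ltn_trans ltl.
  + rewrite el eqn_add2l; move: eu ev; rewrite el /block_col okl => eu ev.
    apply: pcol_neq uv eu ev; rewrite ?inE //.
    by rewrite /block_graph eqxx !inE adj_sym Guv /= -/(lab D w) el.
- by rewrite ltn_eqF // (leq_trans (main_lt _ _ eu)) // leq_addr.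
- by rewrite gtn_eqF // (leq_trans (main_lt _ _ ev)) // leq_addr.
- have [x ex _] := rest_some _ eu; have [y ey _] := rest_some _ ev.
  rewrite ex ey eqn_add2l; move: ex ey; rewrite /rest_col okr => ex ey.
  apply: pcol_neq uv ex ey; first by rewrite inE /left_over ev.
  by rewrite /rest_graph {1}/left_over ev eqxx !inE adj_sym Guv /left_over eu.
Qed.

Lemma better_success D D' w : success D w || success D' w ->
  success (better D D' w) w.
Proof.
rewrite /better; case: ifP => [/andP[]//|].
by case: (success D w); case: (success D' w).
Qed.

Lemma better_palettel D D' w : success D w ->
  palette (better D D' w) w <= palette D w.
Proof.
move=> sD; rewrite /better sD andTb; case: ifP => [_|/negbT]; first exact: leqnn.
by rewrite negb_imply -ltnNge => /andP[_ /ltnW].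
Qed.

Lemma better_paletter D D' w : success D' w ->
  palette (better D D' w) w <= palette D' w.
Proof.
move=> sD'; rewrite /better sD' implyTb; case: ifP => [/andP[]//|_]; exact: leqnn.
Qed.

Lemma label_ext D w w' j : deg w =1 deg w' -> w.2 = w'.2 ->
  label D w j = label D w' j.
Proof. by move=> ed es; apply/funext => v; rewrite !labelE ed es. Qed.

Lemma level_ext D w w' :
  (forall u : 'I_n, level_ok D w u = level_ok D w' u) -> level D w = level D w'.
Proof. by move=> eok; rewrite !levelE; apply: eq_find => u; apply: eok. Qed.

Lemma load_ext (lb lb' : 'I_n -> 'I_n) (S S' : 'I_n -> {set 'I_n}) c :
  lb = lb' -> (forall v, #|S v| = #|S' v|) -> load lb S c = load lb' S' c.
Proof. by move=> -> eS; apply: eq_bigr => v _; rewrite eS. Qed.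

Lemma lab_ext D w w' : level D w = level D w' ->
  (forall j, label D w j = label D w' j) -> lab D w = lab D w'.
Proof. by rewrite /lab => -> ->. Qed.

Lemma block_ext D w w' c : level D w = level D w' -> lab D w = lab D w' ->
  (level D w < n -> block_graph D w c = block_graph D w' c) ->
  block_ncol D w c = block_ncol D w' c /\ block_col D w c = block_col D w' c.
Proof.
rewrite /block_ncol /block_col /block => <- <- eg.
have [lt|_] := boolP (level D w < n); last by split.
by rewrite (eg lt); split.
Qed.

Lemma rest_ext D w w' : rest_ok D w = rest_ok D w' -> rest D w = rest D w' ->
  (rest_ok D w -> rest_graph D w = rest_graph D w') ->
  rest_ncol D w = rest_ncol D w' /\ rest_col D w = rest_col D w'.
Proof.
rewrite /rest_ncol /rest_col => <- <- eg.
have [ok|_] := boolP (rest_ok D w); last by split.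
by rewrite (eg ok); split.
Qed.

(** * Implementation in rounds *)

Section Protocol.
Variable b : nat.
Hypothesis leb2 : n.+1 * n.+1 <= 2 ^ b.
Hypothesis lebK : n ^ K <= 2 ^ b.
Local Notation reach := (@reach n Q b).
Local Notation indist := (indist n Q).

(** The rounds are 11 = 2 + 3 + 1 + 1 + 3 + 1: choosing the level, gathering the blocks, the answers
    of the leaders, announcing the left-over vertices, gathering them at [ord0], and its answer. *)
Lemma reach_pipeline D T (E : indist) : reach T E ->
  (forall w w' x, E w w' x -> [/\ nbhd w.1 x = nbhd w'.1 x,
     deg w =1 deg w' & w.2 = w'.2]) ->
  exists E', [/\ reach (11 + T) E', (forall w w' v, E' w w' v -> E w w' v) &
    forall w w' v, E' w w' v -> [/\ success D w = success D w',
      palette D w = palette D w' & color D w v = color D w' v]].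
Proof.
move=> rE0 kE.
have leb1 : n.+1 <= 2 ^ b by rewrite (leq_trans _ leb2) // leq_pmull.
have lebM : #|{: 'I_n.+1 * option 'I_n}| <= 2 ^ b.
  by rewrite card_prod card_option !card_ord.
have lebb : #|{: bool}| <= 2 ^ b by rewrite card_bool (leq_trans _ leb1).
have klabel w w' x j : E w w' x -> label D w j = label D w' j.
  by move=> /kE[_ ed es]; apply: label_ext.
have kpeers w w' x j : E w w' x -> peers D w j x = peers D w' j x.
  by move=> Ew; rewrite /peers (klabel _ _ _ _ Ew); have [-> _ _] := kE _ _ _ Ew.
have ltS (S : {set 'I_n}) : #|S| < n.+1 by rewrite ltnS -[X in _ <= X]card_ord max_card.
(* Node [x] receives the peer counts for level [x], so that it can decide [level_ok] there. *)
pose E1 : indist := fun w w' x => E w w' x /\ forall v,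
  Ordinal (ltS (peers D w x v)) = Ordinal (ltS (peers D w' x v)).
have rE1 : reach T.+1 E1.
  apply: (@reachS _ _ _ _ _ _ (fun w v x => Ordinal (ltS (peers D w x v)))) => //.
    by rewrite card_ord.
  by move=> x w w' v Ew; apply: val_inj; rewrite /= (kpeers _ _ _ _ Ew).
have kok : knows E1 (fun w u => level_ok D w u).
  move=> w w' x [Ew ec]; apply: eq_forallb => c; congr (_ <= _).
  apply: load_ext => [|u]; first by rewrite (klabel _ _ _ _ Ew).
  by have /(congr1 val) := ec u.
have [E2 [rE2 sub2 kok2]] := reach_bcast rE1 lebb kok.
have klev w w' x : E2 w w' x -> level D w = level D w'.
  by move=> /kok2 eok; apply: level_ext => u; exact: eok.
have E2E w w' x : E2 w w' x -> E w w' x by move=> /sub2[].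
have klab w w' x : E2 w w' x -> lab D w = lab D w'.
  move=> Ew; apply: lab_ext (klev _ _ _ Ew) _ => j.
  exact: klabel (E2E _ _ _ Ew).
have [| |E3 [rE3 sub3 _ kgraph]] :=
    @reach_gather m Q b K _ _ (lab D) (fun w => peers D w (level D w)) leb1 lebK rE2.
- by move=> w w' x /klab ->.
- by move=> w w' x Ew; rewrite (klev _ _ _ Ew) (kpeers _ _ _ _ (E2E _ _ _ Ew)).
have kbg w w' c : E3 w w' c -> level D w < n ->
    block_graph D w c = block_graph D w' c.
  move=> Ew lt; apply/funext => v; rewrite /block_graph.
  have el := klab _ _ _ (sub3 _ _ _ Ew); rewrite -{}[lab D w']el.
  case: eqP => [lv|_]; last by [].
  apply: kgraph Ew _ _ lv.
  by have /forallP := level_okP lt; apply.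
have kblock w w' c : E3 w w' c ->
    block_ncol D w c = block_ncol D w' c /\ block_col D w c = block_col D w' c.
  move=> Ew; apply: block_ext (kbg _ _ _ Ew).
    exact: klev (sub3 _ _ _ Ew).
  exact: klab (sub3 _ _ _ Ew).
have [E4 rE4 [sub4 kncol4 kcol4]] : exists2 E4, reach T.+2.+4 E4 &
   [/\ forall w w' v, E4 w w' v -> E3 w w' v,
       forall w w' v, E4 w w' v -> block_ncol D w =1 block_ncol D w' &
       forall w w' v, E4 w w' v -> forall c, block_col D w c v = block_col D w' c v].
  (* Every leader tells every node its palette size as well, because the color offsets involve all
     blocks. *)
  pose msg w c v : ('I_n.+1 * option 'I_n)%type :=
    (inord (block_ncol D w c), block_col D w c v).
  exists (fun w w' v => E3 w w' v /\ forall c, msg w c v = msg w' c v).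
    apply: reachS rE3 lebM _ => v w w' c Ew.
    by rewrite /msg; have [-> ->] := kblock _ _ _ Ew.
  split=> w w' v [Ew eqm]; [exact: Ew | move=> c | move=> c];
    by have [] := inord_pair_inj (block_ncol_le_n D w c) (block_ncol_le_n D w' c) (eqm c).
have E4E2 w w' v : E4 w w' v -> E2 w w' v by move=> /sub4/sub3.
have kleft : knows E4 (left_over D).
  move=> w w' v Ew; rewrite /left_over (klab _ _ _ (E4E2 _ _ _ Ew)).
  by congr (_ == None); exact: kcol4 Ew _.
have [E5 [rE5 sub5 kleft5]] := reach_bcast rE4 lebb kleft.
have krest w w' v : E5 w w' v -> rest D w = rest D w'.
  by move=> Ew; apply/setP => u; rewrite !inE (kleft5 _ _ _ Ew).
have krg : knows E5 (rest_graph D).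
  move=> w w' v Ew; rewrite /rest_graph (kleft5 _ _ _ Ew) (krest _ _ _ Ew).
  by have [-> _ _] := kE _ _ _ (E2E _ _ _ (E4E2 _ _ _ (sub5 _ _ _ Ew))).
have [//|E6 [rE6 sub6 kcard6 kgraph6]] :=
    @reach_gather m Q b K _ _ (fun=> fun=> ord0) (rest_graph D) leb1 lebK rE5 _ krg.
have krok w w' v : E6 w w' v -> rest_ok D w = rest_ok D w'.
  by move=> Ew; congr (_ <= _); apply: load_ext => // u; exact: kcard6 Ew _.
have kcol0 w w' : E6 w w' ord0 -> rest_ncol D w = rest_ncol D w' /\
    rest_col D w = rest_col D w'.
  move=> Ew; apply: rest_ext; first exact: krok Ew.
    exact: krest (sub6 _ _ _ Ew).
  by move=> ok; apply/funext => v; apply: kgraph6 Ew _ _ _.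
pose msg w (x v : 'I_n) : ('I_n.+1 * option 'I_n)%type :=
  if x == ord0 then (inord (rest_ncol D w), rest_col D w v) else (ord0, None).
exists (fun w w' v => E6 w w' v /\ forall x, msg w x v = msg w' x v); split.
- change (reach T.+2.+4.+4.+1 (fun w w' v => E6 w w' v /\
    forall x, msg w x v = msg w' x v)); apply: reachS rE6 lebM _ => v w w' x Ew.
  rewrite /msg; case: eqP => [x0|_]; last by [].
  by move: Ew; rewrite x0 => /kcol0[-> ->].
- by move=> w w' v [/sub6/sub5/E4E2/E2E].
move=> w w' v [Ew] /(_ ord0); rewrite /msg eqxx.
move=> /(inord_pair_inj (rest_ncol_le_n D w) (rest_ncol_le_n D w'))[ern ef].
have Ew4 := sub5 _ _ _ (sub6 _ _ _ Ew).
have ebn : block_ncol D w =1 block_ncol D w' := kncol4 _ _ _ Ew4.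
have esum (P : pred 'I_n) : \sum_(c | P c) block_ncol D w c =
    \sum_(c | P c) block_ncol D w' c by apply: eq_bigr => c _; apply: ebn.
split.
- by rewrite /success (klev _ _ _ (E4E2 _ _ _ Ew4)) (krok _ _ _ Ew).
- by rewrite /palette esum ern.
- rewrite /color ef (klab _ _ _ (E4E2 _ _ _ Ew4)) (kcol4 _ _ _ Ew4).
  by rewrite !esum.
Qed.

(** Here 24 = 2 + 11 + 11: degrees and random strings are broadcast once, then both variants run on
    the same strings. A string fits into one message because [2 ^ Q <= n]. *)
Lemma reach_better D D' : 2 ^ Q <= n ->
  exists2 E, reach 24 E & knows E (fun w v => color (better D D' w) w v).
Proof.
move=> leQ.
have leb1 : n.+1 <= 2 ^ b by rewrite (leq_trans _ leb2) // leq_pmull.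
have ltS (S : {set 'I_n}) : #|S| < n.+1 by rewrite ltnS -[X in _ <= X]card_ord max_card.
have [||E1 [rE1 sub1 kdeg]] :=
    @reach_bcast m Q b _ _ _ (fun w v => Ordinal (ltS (nbhd w.1 v))) (@reach0 _ _ _).
- by rewrite card_ord.
- by move=> w w' v [e _]; apply: val_inj; rewrite /= e.
have [||E2 [rE2 sub2 kseed]] := @reach_bcast m Q b _ _ _ (fun w v => w.2 v) rE1.
- by rewrite card_tuple card_bool (leq_trans leQ) // ltnW.
- by move=> w w' v /sub1[].
have kE2 w w' x : E2 w w' x -> [/\ nbhd w.1 x = nbhd w'.1 x,
     deg w =1 deg w' & w.2 = w'.2].
  move=> Ew; split; first by have /sub2/sub1[] := Ew.
    by move=> v; have /(congr1 val) := kdeg _ _ _ (sub2 _ _ _ Ew) v.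
  by apply/ffunP => v; apply: kseed Ew _.
have [E3 [rE3 sub3 k3]] := reach_pipeline D rE2 kE2.
have [|E4 [rE4 sub4 k4]] := @reach_pipeline D' _ _ rE3.
  by move=> w w' v /sub3/kE2.
exists E4 => // w w' v Ew.
have [s1 p1 c1] := k3 _ _ _ (sub4 _ _ _ Ew).
have [s2 p2 c2] := k4 _ _ _ Ew.
by rewrite /better s1 s2 p1 p2; case: ifP.
Qed.

End Protocol.
End Algorithm.

(** * Acyclic orientations and greedy coloring *)

Section Orientation.
Variables (T : finType) (e : rel T) (sigma : T -> nat).
Hypothesis e_sym : symmetric e.
Hypothesis sigma_inj : injective sigma.
Implicit Types (W : {set T}).

Definition out_nbhd W v : {set T} := [set u in W | e v u && (sigma v < sigma u)].

Lemma out_nbhdS W W' v : W \subset W' -> #|out_nbhd W v| <= #|out_nbhd W' v|.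
Proof.
move=> /fintype.subsetP sW; apply/subset_leq_card/fintype.subsetP => u.
by rewrite !inE => /andP[/sW -> ->].
Qed.

(** Induction removing the vertex of smallest [sigma]: all its neighbours in [W] are out-neighbours,
    so they block at most [d] of the [d.+1] colors. *)
Lemma greedy_coloring d W : (forall v, v \in W -> #|out_nbhd W v| <= d) ->
  exists col : T -> nat, (forall v, v \in W -> col v < d.+1) /\
    (forall u v, u \in W -> v \in W -> e u v -> u != v -> col u != col v).
Proof.
move: {2}#|W| (leqnn #|W|) => k; elim: k W => [|k IHk] W leW outW.
  exists (fun=> 0); split=> [//|u v uW]; move: leW.
  by rewrite leqn0 => /eqP/cards0_eq W0; rewrite W0 inE in uW.
have [->|/set0Pn[v0 v0W]] := eqVneq W finset.set0.
  by exists (fun=> 0); split=> [//|u v]; rewrite inE.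
have [v vW vmin] : exists2 v, v \in W & forall u, u \in W -> sigma v <= sigma u.
  by case: (@arg_minnP _ v0 (mem W) sigma v0W) => v vW min; exists v.
have [|u uW|col [lt neq]] := IHk (W :\ v).
- by move: leW; rewrite (cardsD1 v W) vW ltnS.
- have /setD1P[_ uW'] := uW.
  by apply: leq_trans (outW _ uW'); apply: out_nbhdS; apply: subsetDl.
have vout u : u \in W -> e v u -> u != v -> u \in out_nbhd W v.
  move=> uW evu uv; rewrite inE uW evu /= ltn_neqAle vmin // andbT.
  by apply: contra uv => /eqP/sigma_inj ->.
have [c cP] : exists c : 'I_d.+1, forall u, u \in out_nbhd W v -> col u != c.
  pose C := [set (inord (col u) : 'I_d.+1) | u in out_nbhd W v].
  have [c cC] : exists c, c \notin C.
    apply/existsP; rewrite -negb_forall; apply/negP => /forallP allC.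
    have : #|C| <= d := leq_trans (leq_imset_card _ _) (outW _ vW).
    rewrite leqNgt => /negP; apply; rewrite -[X in X <= _]card_ord -cardsT.
    by apply/subset_leq_card/fintype.subsetP => c _; apply: allC.
  exists c => u uo; apply: contra cC => /eqP e1; apply/imsetP; exists u => //.
  by rewrite e1 inord_val.
exists (fun u => if u == v then c : nat else col u); split=> [u uW /=|u1 u2 u1W u2W e12 u12 /=].
  by case: eqP => [_|/eqP uv]; [apply: ltn_ord | apply: lt; rewrite !inE uv].
have [e1|n1] := eqVneq u1 v; have [e2|n2] := eqVneq u2 v.
- by rewrite e1 e2 eqxx in u12.
- by rewrite eq_sym cP // vout // -e1.
- by rewrite cP // vout // -e2 e_sym.
- by apply: neq => //; rewrite !inE ?n1 ?n2.
Qed.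

(** Each edge is outgoing at exactly one end. This turns out-degree bounds into edge bounds for
    induced subgraphs. *)
Lemma sum_nbhd_out W : irreflexive e ->
  \sum_(v in W) #|[set u in W | e v u]| = 2 * \sum_(v in W) #|out_nbhd W v|.
Proof.
move=> irr; pose inn v := [set u in W | e v u && (sigma u < sigma v)].
have splitE v : #|[set u in W | e v u]| = #|out_nbhd W v| + #|inn v|.
  rewrite -(cardsID [set u | sigma v < sigma u] [set u in W | e v u]).
  congr (_ + _); apply: eq_card => u; rewrite !inE ?andbA //.
  case: (u \in W); rewrite ?andbF //=; case evu: (e v u); rewrite ?andbF //= !andbT.
  rewrite -leqNgt leq_eqVlt; case: eqP => //= /sigma_inj euv.
  by rewrite euv irr in evu.
rewrite (eq_bigr _ (fun v _ => splitE v)) big_split /= mul2n -addnn; congr (_ + _).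
have cardE (A : T -> T -> bool) v :
    #|[set u in W | A v u]| = \sum_(u in W) A v u.
  by rewrite -sum1dep_card big_mkcondr; apply: eq_bigr => u _; case: (A v u).
rewrite (eq_bigr _ (fun v _ => cardE (fun v u => e v u && (sigma u < sigma v)) v)).
rewrite [in RHS](eq_bigr _ (fun v _ => cardE (fun v u => e v u && (sigma v < sigma u)) v)).
rewrite exchange_big /=; apply: eq_bigr => u _; apply: eq_bigr => v _.
by rewrite e_sym.
Qed.

End Orientation.

Section Degeneracy.
Variables (n : nat) (G : sgraph n).

Lemma degenerate_order k : degenerate G k ->
  exists2 sigma : 'I_n -> nat, injective sigma &
    forall v, #|out_nbhd G sigma [set: 'I_n] v| <= k.
Proof.
move=> /forallP deg.
have ord (S : {set 'I_n}) : exists2 sigma : 'I_n -> nat, {in S &, injective sigma} &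
    forall v, v \in S -> #|out_nbhd G sigma S v| <= k.
  move: {2}#|S| (leqnn #|S|) => j; elim: j S => [|j IHj] S leS.
    exists val => [u v _ _|v]; first exact: val_inj.
    by move: leS; rewrite leqn0 => /eqP/cards0_eq ->; rewrite inE.
  have [->|Sn0] := eqVneq S finset.set0.
    by exists val => [u v|v]; rewrite inE.
  have /existsP[x /andP[xS lex]] := implyP (deg S) Sn0.
  have [|s s_inj outs] := IHj (S :\ x).
    by move: leS; rewrite (cardsD1 x S) xS ltnS.
  (* The low-degree vertex [x] comes first, so its out-neighbours are all its neighbours in [S]; the
     others never have [x] as an out-neighbour. *)
  exists (fun u => if u == x then 0 else (s u).+1) => [u v uS vS|v vS].
    have [->|ux] := eqVneq u x; have [->|vx] := eqVneq v x => //.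
    by case; apply: s_inj; rewrite !inE ?ux ?vx.
  have [->|vx] := eqVneq v x.
    apply: leq_trans lex; apply/subset_leq_card/fintype.subsetP => u.
    by rewrite !inE eqxx => /and3P[-> ->].
  apply: leq_trans (outs v _); last by rewrite !inE vx.
  apply/subset_leq_card/fintype.subsetP => u; rewrite !inE (negbTE vx).
  by case: (u == x); rewrite ?andbF //= ltnS.
have [s s_inj outs] := ord [set: 'I_n].
exists s => [u v|v]; first by apply: s_inj; rewrite inE.
by apply: outs; rewrite inE.
Qed.

Lemma degeneracy_order : exists2 sigma : 'I_n -> nat, injective sigma &
    forall v, #|out_nbhd G sigma [set: 'I_n] v| <= degeneracy G.
Proof.
by apply: degenerate_order; rewrite /degeneracy; case: ex_minnP.
Qed.

End Degeneracy.

(** * Size of the palette for a good seed *)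

Section PaletteBound.
Variables (m Q : nat).
Local Notation n := m.+1.
Variables (G : sgraph n) (s : seeds n Q) (sigma : 'I_n -> nat) (kappa : nat).
Hypothesis sigma_inj : injective sigma.
Hypothesis out_kappa : forall v, #|out_nbhd G sigma [set: 'I_n] v| <= kappa.
Hypothesis ltQ : 2 ^ Q <= m.
Variables (D T j0 : nat).
Let w : world n Q := (G, s).
(* A good block has at most [(4 n / 2 ^ j0) * (4 * 2 ^ j0) + n = 17 n] edges,
   each of them reported by both ends. *)
Let K := 34.

Definition high : {set 'I_n} := [set v | D <= #|nbhd G v|].

Definition same_out j v : {set 'I_n} :=
  [set u | [&& G v u, sigma v < sigma u, u \notin high &
             take j (s u) == take j (s v)]].

(** The threshold is [T / 2 ^ j], multiplied out. Blocks with about [T / 2 ^ j] colors each use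
    about [T] in total, so one [T] serves all levels. *)
Definition crowded j : {set 'I_n} :=
  [set v | (v \notin high) && (T < #|same_out j v| * 2 ^ j)].

(** The labels available to low vertices; a prefix of a [Q]-bit string has length [minn j Q]. *)
Definition codes j : {set 'I_n} :=
  [set (inord (enum_rank t) : 'I_n) | t : (minn j Q).-tuple bool].

Let code_lt j (t : (minn j Q).-tuple bool) : enum_rank t < m.
Proof.
apply: leq_trans (ltn_ord _) _; rewrite card_tuple card_bool.
by apply: leq_trans ltQ; rewrite leq_exp2l // geq_minr.
Qed.

Lemma card_codes j : #|codes j| <= 2 ^ j.
Proof.
apply: leq_trans (leq_imset_card _ _) _; rewrite cardT -cardE card_tuple card_bool.
by rewrite leq_exp2l // geq_minl.
Qed.

Lemma code_neq_max j c : c \in codes j -> c != ord_max.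
Proof.
case/imsetP => t _ ->; apply/eqP => /(congr1 val) /=.
rewrite inordK; last by rewrite ltnS ltnW // code_lt.
by move=> e; have := code_lt t; rewrite e ltnn.
Qed.

Lemma label_high j v : v \in high -> label D w j v = ord_max.
Proof. by rewrite inE labelE /deg => ->. Qed.

Lemma label_low j v : v \notin high ->
  label D w j v = inord (enum_rank [tuple of take j (s v)]).
Proof. by rewrite inE labelE /deg => /negbTE ->. Qed.

Lemma label_low_codes j v : v \notin high -> label D w j v \in codes j.
Proof. by move=> /label_low ->; apply/imsetP; eexists. Qed.

Lemma label_max j v : label D w j v = ord_max -> v \in high.
Proof.
by move=> e; apply/negPn/negP => /label_low_codes-/(_ j)/code_neq_max; rewrite e eqxx.
Qed.

Lemma label_take j u v : label D w j u = label D w j v -> u \notin high ->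
  v \notin high /\ take j (s u) = take j (s v).
Proof.
move=> e uH; have vH : v \notin high.
  apply/negP => /label_high-/(_ j) emax; move: uH.
  by rewrite (@label_max j) // e.
split=> //; move: e; rewrite !label_low // => /(congr1 val) /=.
have lt t : enum_rank (t : (minn j Q).-tuple bool) < n by rewrite ltnS ltnW // code_lt.
by rewrite !inordK // => /val_inj/enum_rank_inj/(congr1 val).
Qed.

Let out_kappaW (W : {set 'I_n}) v : #|out_nbhd G sigma W v| <= kappa.
Proof.
apply: leq_trans (out_kappa v); apply: out_nbhdS.
by apply/fintype.subsetP => u _; rewrite inE.
Qed.

Lemma class_out j c v (W : {set 'I_n}) :
  c != ord_max -> (forall u, u \in W -> label D w j u = c) -> v \in W ->
  v \notin high /\ out_nbhd G sigma W v \subset same_out j v.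
Proof.
move=> cmax labW vW.
have low u : u \in W -> u \notin high.
  by move=> uW; apply/negP => /label_high-/(_ j) e; rewrite -(labW u uW) e eqxx in cmax.
split; first exact: low.
apply/fintype.subsetP => u; rewrite !inE => /andP[uW /andP[-> ->]] /=.
have uH := low u uW; rewrite -[~~ _]/(~~ (_ <= _)).
have [_ ->] := @label_take j u v (etrans (labW u uW) (esym (labW v vW))) uH.
by move: uH; rewrite inE => ->; rewrite eqxx.
Qed.

Let load_class j c (W := [set v | label D w j v == c]) :
  load (label D w j) (peers D w j) c = 2 * \sum_(v in W) #|out_nbhd G sigma W v|.
Proof.
rewrite -(sum_nbhd_out (@adj_sym _ G) sigma_inj W (@adj_irr _ G)) /load.
rewrite [RHS](eq_bigl (fun v => label D w j v == c)); last by move=> v; rewrite inE.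
apply: eq_bigr => v /eqP lv; apply: eq_card => u.
by rewrite !inE lv andbC.
Qed.

(** The level actually selected may lie anywhere below [j0], so crowding is controlled at all these
    levels, whereas block sizes matter only for showing that [j0] itself is admissible. *)
Hypothesis crowded_le : forall j, j <= j0 -> #|crowded j| <= n %/ D.
Hypothesis block_le : forall z : seq bool,
  #|[set v | take j0 (s v) == z]| * 2 ^ j0 <= 4 * n.
Hypothesis high_le : 2 * (kappa * #|high|) <= K * n.
Hypothesis rest_le : 2 * (kappa * ((2 ^ j0).+1 * (n %/ D))) <= K * n.
Hypothesis ltT : T < 4 ^ j0.+1.
Hypothesis j0Q : j0 <= Q.

Let j0n : j0 < n.
Proof. by apply: leq_ltn_trans j0Q _; rewrite ltnS (leq_trans _ ltQ) // ltnW // ltn_expl. Qed.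

Lemma level_ok_j0 : level_ok K D w j0.
Proof.
apply/forallP => c; rewrite load_class.
set W := [set v | _].
have [ecm|cmax] := eqVneq c ord_max.
  apply: leq_trans high_le; rewrite leq_mul2l /= mulnC -sum_nat_const.
  apply: (@leq_trans (\sum_(v in W) kappa)); first by apply: leq_sum => v _.
  rewrite !sum_nat_const leq_mul2r; apply/orP; right; apply/subset_leq_card.
  by apply/fintype.subsetP => v; rewrite inE ecm => /eqP/label_max.
have labW u : u \in W -> label D w j0 u = c by rewrite inE => /eqP.
have bound : \sum_(v in W) #|out_nbhd G sigma W v| <= 17 * n.
  (* An uncrowded vertex has at most [T / 2 ^ j0 <= 4 * 2 ^ j0] out-neighbours in its block, by
     [ltT]; a crowded one is low, hence has fewer than [D] neighbours. *)
  apply: (@leq_trans (\sum_(v in W) (4 * 2 ^ j0) + \sum_(v in crowded j0) D)).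
    rewrite (bigID (mem (crowded j0))) /= addnC; apply: leq_add.
      rewrite [X in X <= _](_ : _ = \sum_(v in W | v \notin crowded j0) #|out_nbhd G sigma W v|) //.
      rewrite [X in _ <= X](bigID (mem (crowded j0))) /=.
      apply: leq_trans (leq_addl _ _); apply: leq_sum => v /andP[vW].
      have [vH /subset_leq_card le] := class_out cmax labW vW.
      rewrite !inE -/high; move: (vH); rewrite inE => -> /=; rewrite -leqNgt => leX.
      apply: leq_trans le _; rewrite -(leq_pmul2r (expn_gt0 2 j0)) -mulnA -expnD addnn -mul2n expnM.
      by rewrite (leq_trans leX) // (leq_trans (ltnW ltT)) // expnS.
    apply: (@leq_trans (\sum_(v in W | v \in crowded j0) D)).
      apply: leq_sum => v /andP[vW _]; have [vH /subset_leq_card le] := class_out cmax labW vW.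
      apply: leq_trans le _; move: vH; rewrite inE -ltnNge => /ltnW; apply: leq_trans.
      by apply/subset_leq_card/fintype.subsetP => u; rewrite !inE => /andP[].
    rewrite big_mkcond [X in _ <= X]big_mkcond; apply: leq_sum => v _.
    by case: ifP => // /andP[_ ->].
  rewrite !sum_nat_const (_ : 17 = 4 * 4 + 1) // mulnDl mul1n; apply: leq_add.
    have [->|/set0Pn[v vW]] := eqVneq W finset.set0; first by rewrite cards0.
    rewrite mulnCA -mulnA leq_mul2l /=; apply: leq_trans (block_le (take j0 (s v))).
    rewrite leq_mul2r; apply/orP; right; apply/subset_leq_card/fintype.subsetP => u uW.
    have [uH _] := class_out cmax labW uW; rewrite inE.
    by have [_ ->] := label_take (etrans (labW u uW) (esym (labW v vW))) uH.
  by apply: leq_trans (leq_trunc_div n D); rewrite leq_mul2r crowded_le ?orbT.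
by rewrite (_ : K * n = 2 * (17 * n)) ?leq_mul2l //= mulnA.
Qed.

Let lev := level K D w.

Lemma level_le_j0 : lev <= j0.
Proof. exact: level_le j0n level_ok_j0. Qed.

Let lev_n : lev < n := leq_ltn_trans level_le_j0 j0n.

Lemma block_empty c : c \notin codes lev -> c != ord_max -> block K D w c = finset.set0.
Proof.
move=> cC cmax; apply/setP => v; rewrite !inE; apply/negP => /eqP lv.
have [vH|vH] := boolP (v \in high).
  by rewrite -lv /lab label_high ?eqxx in cmax.
by rewrite -lv label_low_codes in cC.
Qed.

(** Apart from [ord_max] only the at most [2 ^ lev] codes label a nonempty block. *)
Lemma sum_blocks (F : 'I_n -> nat) A B :
  (forall c, block K D w c = finset.set0 -> F c = 0) ->
  F ord_max <= A -> (forall c, c != ord_max -> F c <= B) ->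
  \sum_c F c <= A + 2 ^ lev * B.
Proof.
move=> F0 FA FB; rewrite (bigD1 ord_max) //=; apply: leq_add => //.
apply: (@leq_trans (\sum_(c in codes lev) B)); last first.
  by rewrite sum_nat_const leq_mul2r card_codes orbT.
rewrite big_mkcond [X in _ <= X]big_mkcond; apply: leq_sum => c _.
case: ifP => // cmax; case: ifP => [_|/negbT cC]; first exact: FB.
by rewrite F0 // block_empty.
Qed.

Lemma ncol_empty tau g : @ncol n tau finset.set0 g = 0.
Proof.
apply/eqP; rewrite -leqn0; apply: (@ncol_le _ _ _ _ finset.set0 _ (fun=> 0)).
- by rewrite cards0.
- by move=> v; rewrite inE.
- by move=> u v; rewrite inE.
Qed.

Lemma ncol_kappa tau (W : {set 'I_n}) (g : 'I_n -> {set 'I_n}) :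
  (forall v u, v \in W -> u \in g v -> G v u) -> ncol tau W g <= kappa.+1.
Proof.
move=> gG; have [col [lt neq]] :=
  @greedy_coloring _ G sigma (@adj_sym _ G) sigma_inj kappa W (fun v _ => out_kappaW W v).
apply: (@ncol_le _ _ _ _ finset.set0 _ col); first by rewrite cards0.
  by move=> v vW _; apply: lt.
by move=> u v uW vW _ _ /(gG _ _ vW); rewrite adj_sym; apply: neq.
Qed.

Lemma block_graphP c v u : v \in block K D w c -> u \in block_graph K D w c v -> G v u.
Proof. by rewrite !inE /block_graph => ->; rewrite !inE => /andP[]. Qed.

(** Greedy coloring of the uncrowded part, the crowded vertices being the exceptional set. The
    successor, summed over blocks, becomes the term [2 ^ j0] of the palette. *)
Lemma block_ncol_low c : c != ord_max ->
  block_ncol K D w c <= (T %/ 2 ^ lev).+1.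
Proof.
move=> cmax; rewrite /block_ncol lev_n.
set W := block K D w c; pose W' := W :\: crowded lev.
have labW u : u \in W' -> label D w lev u = c by rewrite !inE => /andP[_ /eqP].
have [col [lt neq]] : exists col : 'I_n -> nat,
   (forall v, v \in W' -> col v < (T %/ 2 ^ lev).+1) /\
    (forall u v, u \in W' -> v \in W' -> G u v -> u != v -> col u != col v).
  apply: (greedy_coloring (@adj_sym _ G) sigma_inj) => v vW.
  have [vH /subset_leq_card le] := class_out cmax labW vW.
  apply: leq_trans le _; rewrite leq_divRL ?expn_gt0 //.
  by move: vW; rewrite inE => /andP[+ _]; rewrite inE vH /= -leqNgt.
apply: (@ncol_le _ _ _ _ (crowded lev) _ col).
- exact: crowded_le level_le_j0.
- by move=> v vW vc; apply: lt; rewrite inE vW vc.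
- move=> u v uW vW uc vc /(block_graphP vW); rewrite adj_sym => Guv.
  by apply: neq; rewrite // inE ?uW ?vW ?uc ?vc.
Qed.

Lemma block_ncol_empty c : block K D w c = finset.set0 -> block_ncol K D w c = 0.
Proof. by rewrite /block_ncol => ->; rewrite ncol_empty if_same. Qed.

Lemma block_ncol_high :
  block_ncol K D w ord_max <= if high == finset.set0 then 0 else kappa.+1.
Proof.
case: eqP => [H0|_]; last first.
  rewrite /block_ncol lev_n; apply: ncol_kappa => v u; exact: block_graphP.
rewrite block_ncol_empty //; apply/setP => v; rewrite !inE; apply/negP.
by move=> /eqP/label_max; rewrite H0 inE.
Qed.

Lemma card_rest : #|rest K D w| <= (2 ^ lev).+1 * (n %/ D).
Proof.
pose F c := #|[set v in block K D w c | block_col K D w c v == None]|.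
have -> : #|rest K D w| = \sum_c F c.
  rewrite -sum1_card (partition_big (lab K D w) predT) //=.
  apply: eq_bigr => c _; rewrite /F -sum1dep_card; apply: eq_bigl => v.
  by rewrite !inE andbC; case: (lab K D w v =P c) => [<-|].
have leF c : F c <= n %/ D by rewrite /F /block_col lev_n; apply: pcol_card.
rewrite mulSn; apply: sum_blocks => // c b0; rewrite /F b0.
by apply/eqP; rewrite cards_eq0; apply/eqP/setP => v; rewrite !inE.
Qed.

Lemma rest_ok_j0 : rest_ok K D w.
Proof.
rewrite /rest_ok /load.
have -> : \sum_(v | ord0 == ord0 :> 'I_n) #|rest_graph K D w v| =
    \sum_(v in rest K D w) #|[set u in rest K D w | G v u]|.
  rewrite [LHS]big_mkcond [RHS]big_mkcond; apply: eq_bigr => v _; rewrite inE.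
  rewrite /rest_graph; case: ifP => _; last by rewrite cards0.
  by apply: eq_card => u; rewrite !inE andbC.
rewrite (sum_nbhd_out (@adj_sym _ G) sigma_inj _ (@adj_irr _ G)).
apply: leq_trans rest_le; rewrite leq_mul2l /=.
apply: (@leq_trans (\sum_(v in rest K D w) kappa)); first by apply: leq_sum => v _.
rewrite sum_nat_const mulnC leq_mul2l; apply/orP; right.
apply: leq_trans card_rest _; rewrite leq_mul2r ltnS leq_exp2l //.
by rewrite level_le_j0 orbT.
Qed.

Lemma rest_ncol_j0 : rest_ncol K D w <= if n %/ D == 0 then 0 else kappa.+1.
Proof.
rewrite /rest_ncol rest_ok_j0; case: eqP => [t0|_].
  have := card_rest; rewrite t0 muln0 leqn0 => /eqP/cards0_eq ->.
  by rewrite ncol_empty.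
apply: ncol_kappa => v u; rewrite inE /rest_graph => ->.
by rewrite !inE => /andP[].
Qed.

(** For [D > n] both conditional terms vanish, which gives the variant for large degeneracy. *)
Lemma palette_bound : success K D w /\
  palette K D w <= T + 2 ^ j0 + (if high == finset.set0 then 0 else kappa.+1)
                   + (if n %/ D == 0 then 0 else kappa.+1).
Proof.
split; first by apply/andP; split; [exact: lev_n | exact: rest_ok_j0].
rewrite /palette; apply: leq_add rest_ncol_j0.
apply: leq_trans (sum_blocks block_ncol_empty block_ncol_high block_ncol_low) _.
rewrite addnC leq_add2r mulnS addnC leq_add ?leq_exp2l ?level_le_j0 //.
by rewrite mulnC leq_trunc_div.
Qed.

End PaletteBound.

(** * Finite probability *)

Section FiniteProbability.
Variables (R : realType) (T : finType).
Hypothesis T_gt0 : 0 < #|T|.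
Local Open Scope ring_scope.
Implicit Types (E F : pred T) (f g : T -> R).

Definition mean f : R := (\sum_s f s) / #|T|%:R.

Lemma prob_mean E : prob R E = mean (fun s => (E s)%:R).
Proof.
rewrite /prob /mean -sum1dep_card natr_sum big_mkcond; congr (_ / _).
by apply: eq_bigr => s _; case: (E s).
Qed.

Lemma ler_mean f g : (forall s, f s <= g s) -> mean f <= mean g.
Proof.
move=> le; rewrite ler_wpM2r ?invr_ge0 ?ler0n //.
by apply: ler_sum => s _; apply: le.
Qed.

Lemma meanD f g : mean (fun s => f s + g s) = mean f + mean g.
Proof. by rewrite /mean big_split mulrDl. Qed.

Lemma mean_sum (I : finType) (F : I -> T -> R) :
  mean (fun s => \sum_i F i s) = \sum_i mean (F i).
Proof. by rewrite /mean exchange_big /= mulr_suml. Qed.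

Lemma meanZ a f : mean (fun s => a * f s) = a * mean f.
Proof. by rewrite /mean -mulr_sumr mulrA. Qed.

Lemma mean_cst a : mean (fun=> a) = a.
Proof.
by rewrite /mean sumr_const -[a *+ _]mulr_natr mulfK // pnatr_eq0 -lt0n.
Qed.

Lemma eq_mean f g : f =1 g -> mean f = mean g.
Proof. by move=> e; rewrite /mean (eq_bigr _ (fun s _ => e s)). Qed.

Lemma prob_le_mean E f : (forall s, 0 <= f s) -> (forall s, E s -> 1 <= f s) ->
  prob R E <= mean f.
Proof.
move=> f0 f1; rewrite prob_mean; apply: ler_mean => s.
by case Es: (E s) => //; apply: f1.
Qed.

Lemma prob_exists (I : finType) (E : I -> pred T) p : (forall i, prob R (E i) <= p) ->
  prob R (fun s => [exists i, E i s]) <= #|I|%:R * p.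
Proof.
move=> le; apply: (@le_trans _ _ (\sum_i prob R (E i))); last first.
  apply: le_trans (ler_sum _ (fun i _ => le i)) _.
  by rewrite sumr_const mulr_natl.
under eq_bigr do rewrite prob_mean; rewrite -mean_sum.
apply: prob_le_mean => s; first by apply: sumr_ge0 => i _.
case/existsP => i Ei; rewrite (bigD1 i) //= Ei lerDl.
by apply: sumr_ge0 => ? _.
Qed.

Lemma prob_or E F : prob R (fun s => E s || F s) <= prob R E + prob R F.
Proof.
rewrite !prob_mean -meanD; apply: ler_mean => s.
by case: (E s); case: (F s); rewrite /= ?addr0 ?add0r // lerDl.
Qed.

Lemma prob_imply E F : (forall s, E s -> F s) -> prob R E <= prob R F.
Proof.
move=> imp; rewrite !prob_mean; apply: ler_mean => s.
by case Es: (E s); rewrite ?(imp _ Es).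
Qed.

Lemma prob_compl E F : (forall s, ~~ E s -> F s) -> 1 - prob R E <= prob R F.
Proof.
move=> imp; rewrite lerBlDr !prob_mean -meanD -[X in X <= _](mean_cst 1).
apply: ler_mean => s; case Es: (E s); first by rewrite lerDr.
by rewrite imp ?Es // addr0.
Qed.

Lemma prob_chernoff (X : T -> R) a b theta : 0 <= theta ->
  mean (fun s => expR (theta * X s)) <= expR b ->
  prob R (fun s => a <= X s) <= expR (b - theta * a).
Proof.
move=> t0 le; apply: (@le_trans _ _ (mean (fun s => expR (- (theta * a)) * expR (theta * X s)))).
  apply: prob_le_mean => s; first by rewrite mulr_ge0 ?expR_ge0.
  move=> aX; rewrite -expRD -[X in X <= _]expR0 ler_expR addrC subr_ge0.
  by rewrite ler_wpM2l.
by rewrite meanZ addrC expRD ler_wpM2l ?expR_ge0.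
Qed.

End FiniteProbability.

(** * Independence in product spaces *)

Section ProductSpace.
Variables (R : realType) (I A : finType).
Local Notation T := {ffun I -> A}.
Local Open Scope ring_scope.
Implicit Types (f g : T -> R) (S : {set I}).

Definition depends_on S (Y : Type) (f : T -> Y) :=
  forall s s' : T, (forall i, i \in S -> s i = s' i) -> f s = f s'.

Lemma mean_prod (F : I -> A -> R) :
  mean (fun s : T => \prod_i F i (s i)) = \prod_i mean (F i).
Proof.
rewrite /mean -(bigA_distr_bigA F) big_split /= prodr_const; congr (_ * _).
by rewrite card_ffun natrX exprVn.
Qed.

(* Swapping the coordinates of a pair of samples inside [S] is an involution
   of the product space, and it turns [f s * g s] into [f s * g s']. *)
Lemma mean_indep S f g : depends_on S f -> depends_on (~: S) g ->
  mean (fun s => f s * g s) = mean f * mean g.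
Proof.
move=> df dg; pose mix (s s' : T) : T := [ffun i => if i \in S then s i else s' i].
pose swap (p : T * T) := (mix p.1 p.2, mix p.2 p.1).
have swapK : involutive swap.
  by case=> s s'; congr (_, _); apply/ffunP => i; rewrite /= !ffunE; case: (i \in S).
have [T0|T_gt0] := posnP #|{: T}|.
  by rewrite /mean T0 invr0 !mulr0.
have nz : #|{: T}|%:R != 0 :> R by rewrite pnatr_eq0 -lt0n.
apply: (mulIf nz); apply: (mulIf nz); rewrite /mean mulfVK //.
rewrite [RHS](_ : _ = (\sum_s f s) * (\sum_s g s)); last by field.
rewrite big_distrlr /= pair_big /= (reindex_inj (inv_inj swapK)) /=.
rewrite -(pair_big xpredT xpredT (fun s s' => f (mix s s') * g (mix s' s))) /=.
have fE s s' : f (mix s s') = f s by apply: df => i iS; rewrite ffunE iS.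
have gE s s' : g (mix s' s) = g s.
  by apply: dg => i; rewrite inE => iS; rewrite ffunE (negbTE iS).
under [RHS]eq_bigr do under eq_bigr do rewrite fE gE.
by under [RHS]eq_bigr do rewrite sumr_const -mulr_natr; rewrite -mulr_suml.
Qed.

Lemma mean_prod_indep (J : eqType) (r : seq J) (S : J -> {set I}) (f : J -> T -> R) :
  (0 < #|{: T}|)%N -> uniq r -> (forall j, j \in r -> depends_on (S j) (f j)) ->
  {in r &, forall j k, j != k -> [disjoint S j & S k]} ->
  mean (fun s => \prod_(j <- r) f j s) = \prod_(j <- r) mean (f j).
Proof.
move=> T_gt0; elim: r => [|j r IHr] /=.
  by move=> _ _ _; rewrite big_nil -[RHS](mean_cst T_gt0); apply: eq_mean => s; rewrite big_nil.
case/andP => jr ur dep disj; rewrite big_cons -IHr //; first last.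
- by move=> k l kr lr; apply: disj; rewrite inE ?kr ?lr orbT.
- by move=> k kr; apply: dep; rewrite inE kr orbT.
rewrite -(@mean_indep (S j)).
- by apply: eq_mean => s; rewrite big_cons.
- by apply: dep; rewrite inE eqxx.
move=> s s' es; rewrite !big_seq; apply: eq_bigr => k kr.
apply: dep => [|i iS]; first by rewrite inE kr orbT.
apply: es; rewrite inE.
have jk : j != k by apply: contraNneq jr => ->.
have := disj j k; rewrite !inE eqxx kr orbT => /(_ isT isT jk).
by rewrite disjoint_sym => /disjointFr/(_ iS) ->.
Qed.

End ProductSpace.

(** * Elementary bounds on the exponential *)

Section ExpBounds.
Variable R : realType.
Local Open Scope ring_scope.
Implicit Types x : R.

(** From [expR (- x) >= 1 - x], since [(1 - x) * (1 + x + 2 * x ^+ 2) = 1 + x ^+ 2 * (1 - 2 * x) >=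
    1]. *)
Lemma expR_le_quad x : 0 <= x <= 2^-1 -> expR x <= 1 + x + 2 * x ^+ 2.
Proof.
move=> /andP[x0 x2]; have := expR_ge1Dx (- x); rewrite expRN => le.
have e0 := expR_gt0 x.
have : expR x * (1 - x) <= 1.
  by rewrite -[X in _ <= X](mulfV (lt0r_neq0 e0)) ler_pM2l.
rewrite expr2; nra.
Qed.

Lemma expR1_le4 : expR 1 <= 4 :> R.
Proof.
have -> : 1 = 2%:R * 2^-1 :> R by rewrite mulfV.
rewrite expRM_natl; have := @expR_le_quad 2^-1.
rewrite lexx invr_ge0 ler0n => /(_ isT); have := expR_ge0 (2^-1 : R).
rewrite !expr2; set e := expR _ => e0 le; nra.
Qed.

End ExpBounds.

(** * Moments of the random partition *)

Section BlockMoments.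
Variables (R : realType) (n Q : nat).
Local Notation A := (Q.-tuple bool).
Local Notation seeds := (seeds n Q).
Local Open Scope ring_scope.

Lemma card_take_eq j (z : seq bool) : (j <= Q)%N ->
  (#|[set x : A | take j x == z]| <= 2 ^ (Q - j))%N.
Proof.
move=> jQ; set B := [set x | _].
have inj : {in B &, injective (fun x : A => [tuple of drop j x])}.
  move=> x y; rewrite !inE => /eqP ex /eqP ey /(congr1 val) /= ed.
  by apply: val_inj; rewrite /= -(cat_take_drop j x) ex ed -ey cat_take_drop.
rewrite -(card_in_imset inj); apply: leq_trans (max_card _) _.
by rewrite card_tuple card_bool.
Qed.

Lemma card_coins_gt0 : (0 < #|{: A}|)%N.
Proof. by rewrite card_tuple card_bool expn_gt0. Qed.

Lemma card_seeds_gt0 : (0 < #|{: seeds}|)%N.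
Proof. by rewrite card_ffun expn_gt0 card_coins_gt0. Qed.

Lemma prob_take_eq j (z : seq bool) : (j <= Q)%N ->
  prob R (fun x : A => take j x == z) <= (2 ^+ j)^-1.
Proof.
move=> jQ; rewrite /prob card_tuple card_bool ler_pdivrMr ?ltr0n ?expn_gt0 //.
rewrite ler_pdivlMl ?exprn_gt0 // -natrX -natrM ler_nat mulnC.
apply: leq_trans (leq_mul (card_take_eq z jQ) (leqnn _)) _.
by rewrite -expnD subnK.
Qed.

Lemma mean_expR_bool (T : finType) (E : pred T) theta p : (0 < #|T|)%N ->
  0 <= theta -> prob R E <= p ->
  mean (fun x => expR (theta * (E x)%:R)) <= expR ((expR theta - 1) * p).
Proof.
move=> T_gt0 t0 le.
rewrite (@eq_mean _ _ _ (fun x => 1 + (expR theta - 1) * (E x)%:R)); last first.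
  by move=> x; case: (E x); rewrite ?mulr1 ?mulr0 ?expR0; ring.
rewrite meanD meanZ mean_cst // -prob_mean.
apply: le_trans (expR_ge1Dx _); rewrite lerD2l ler_wpM2l // subr_ge0.
by rewrite -[X in X <= _]expR0 ler_expR.
Qed.

Lemma expR_card (I : finType) (E : pred I) (theta : R) :
  expR (theta * #|[set i | E i]|%:R) = \prod_i expR (theta * (E i)%:R).
Proof.
rewrite -expR_sum -mulr_sumr; congr (expR (_ * _)).
by rewrite -sum1dep_card natr_sum big_mkcond; apply: eq_bigr => i _; case: (E i).
Qed.

Lemma mean_expR_block j (z : seq bool) : (j <= Q)%N ->
  mean (fun s : seeds => expR (1 * #|[set v | take j (s v) == z]|%:R)) <=
  expR (3 * n%:R / 2 ^+ j) :> R.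
Proof.
move=> jQ; under eq_mean do rewrite expR_card.
rewrite (mean_prod (fun (_ : 'I_n) (x : A) => expR (1 * (take j x == z)%:R))).
rewrite prodr_const card_ord.
apply: le_trans (_ : expR (3 / 2 ^+ j) ^+ n <= _); last first.
  by rewrite -expRM_natl; rewrite le_eqVlt; apply/orP; left; apply/eqP; congr expR; ring.
rewrite lerXn2r ?nnegrE ?expR_ge0 //.
  by rewrite mulr_ge0 ?invr_ge0 ?ler0n // sumr_ge0 // => x _; apply: expR_ge0.
apply: le_trans (mean_expR_bool card_coins_gt0 ler01 (prob_take_eq z jQ)) _.
rewrite ler_expR ler_wpM2r ?invr_ge0 ?exprn_ge0 //.
by have := expR1_le4 R; lra.
Qed.

(** The events share the string of [v]. Splitting over its value [a], with the factor [x == a] at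
    coordinate [v], makes each summand a product over coordinates; [v \notin U] keeps the other
    factors separate. *)
Lemma mean_expR_same j (v : 'I_n) (U : {set 'I_n}) (theta : R) :
  (j <= Q)%N -> 0 <= theta -> v \notin U ->
  mean (fun s : seeds =>
    expR (theta * #|[set u | (u \in U) && (take j (s u) == take j (s v))]|%:R)) <=
  expR (#|U|%:R * ((expR theta - 1) / 2 ^+ j)).
Proof.
move=> jQ t0 vU; set beta := _ / _.
pose F (a : A) u (x : A) : R := if u == v then (x == a)%:R
  else expR (theta * ((u \in U) && (take j x == take j a))%:R).
rewrite (@eq_mean _ _ _ (fun s : seeds => \sum_a \prod_u F a u (s u))); last first.
  move=> s; rewrite expR_card (bigD1 (s v)) //= [X in _ + X]big1 ?addr0.
    apply: eq_bigr => u _; rewrite /F; case: (u =P v) => [->|//].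
    by rewrite [s v == s v]eqxx (negbTE vU) mulr0 expR0.
  move=> a; rewrite eq_sym => sa; rewrite (bigD1 v) //= /F eqxx (negbTE sa).
  by rewrite mul0r.
rewrite mean_sum; under eq_bigr do rewrite mean_prod.
have A0 : #|{: A}|%:R != 0 :> R by rewrite pnatr_eq0 -lt0n card_coins_gt0.
have cardU : #|U|%:R * beta = \sum_(u | u != v) (u \in U)%:R * beta.
  rewrite -mulr_suml; congr (_ * _); rewrite -sum1_card natr_sum.
  rewrite [LHS]big_mkcond [RHS]big_mkcond; apply: eq_bigr => u _.
  by case: (u =P v) => [->|_]; [rewrite (negbTE vU) | case: (u \in U)].
have le a : \prod_u mean (F a u) <= #|{: A}|%:R^-1 * expR (#|U|%:R * beta).
  rewrite (bigD1 v) //= [X in X * _](_ : _ = #|{: A}|%:R^-1); last first.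
    rewrite /mean (bigD1 a) //= big1 ?addr0 /F ?eqxx ?mul1r //.
    by move=> b ba; rewrite (negbTE ba).
  rewrite ler_wpM2l ?invr_ge0 ?ler0n // cardU expR_sum; apply: ler_prod => u uv.
  rewrite mulr_ge0 ?invr_ge0 ?ler0n ?sumr_ge0 //=; last first.
    by move=> x _; rewrite /F (negbTE uv) expR_ge0.
  rewrite /F (negbTE uv); case: (u \in U); last first.
    by rewrite /= mulr0 mul0r expR0 mean_cst ?card_coins_gt0.
  by rewrite /= mul1r; apply: mean_expR_bool => //; [exact: card_coins_gt0 | exact: prob_take_eq].
apply: le_trans (ler_sum _ (fun a _ => le a)) _.
by rewrite -mulr_suml sumr_const -[_^-1 *+ _]mulr_natr mulVf // mul1r.
Qed.

Lemma prob_block_large j : (j <= Q)%N ->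
  prob R (fun s : seeds => [exists t : j.-tuple bool,
    (4 * n < #|[set v | take j (s v) == t]| * 2 ^ j)%N]) <=
  2 ^+ j * expR (- (n%:R / 2 ^+ j)).
Proof.
move=> jQ.
apply: le_trans (prob_exists (E := fun (t : j.-tuple bool) (s : seeds) =>
    (4 * n < #|[set v | take j (s v) == t]| * 2 ^ j)%N) _) _; last first.
  by rewrite card_tuple card_bool natrX.
move=> t /=; set X : seeds -> nat := fun s => #|[set v | take j (s v) == t]|.
apply: le_trans (prob_imply R (F := fun s : seeds => 4 * n%:R / 2 ^+ j <= (X s)%:R :> R) _) _.
  move=> s lt /=; rewrite ler_pdivrMr ?exprn_gt0 // -natrX -!natrM ler_nat.
  exact: ltnW.
(* The threshold [4 n / 2 ^ j] exceeds the exponent [3 n / 2 ^ j] of the moment bound, where 3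
   bounds [expR 1 - 1]. *)
apply: le_trans (prob_chernoff _ ler01 (mean_expR_block t jQ)) _.
rewrite ler_expR mul1r; lra.
Qed.

End BlockMoments.

(** * Concentration of the crowded vertices *)

Section Crowding.
Variables (R : realType) (m Q : nat).
Local Notation n := m.+1.
Variables (G : sgraph n) (sigma : 'I_n -> nat) (kappa : nat).
Hypothesis out_kappa : forall v, #|out_nbhd G sigma [set: 'I_n] v| <= kappa.
Variables (D T : nat).
Local Notation seeds := (seeds n Q).

Definition low_out v : {set 'I_n} :=
  [set u | [&& G v u, sigma v < sigma u & u \notin high G D]].

Lemma same_outE (s : seeds) j v : same_out G s sigma D j v =
  [set u | (u \in low_out v) && (take j (s u) == take j (s v))].
Proof. by apply/setP => u; rewrite !inE -!andbA. Qed.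

Lemma low_out_self v : v \notin low_out v.
Proof. by rewrite inE adj_irr. Qed.

Lemma card_low_out v : #|low_out v| <= kappa.
Proof.
apply: leq_trans (out_kappa v); apply/subset_leq_card/fintype.subsetP => u.
by rewrite !inE => /and3P[-> ->].
Qed.

(** The coordinates of the seed that decide whether [v] is crowded. *)
Definition support v : {set 'I_n} := v |: low_out v.

Definition conflict u v : bool :=
  [&& u \notin high G D, v \notin high G D, u != v &
    ~~ [disjoint support u & support v]].

Lemma conflict_sym : symmetric conflict.
Proof.
by move=> u v; rewrite /conflict eq_sym disjoint_sym; case: (u \in _); case: (v \in _).
Qed.

Lemma support_low v x : v \notin high G D -> x \in support v -> x \notin high G D.
Proof. by move=> vH /setU1P[->//|]; rewrite !inE => /and3P[]. Qed.

Lemma card_closed_nbhd v : v \notin high G D -> #|v |: nbhd G v| <= D.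
Proof.
rewrite inE -ltnNge => lt; apply: leq_trans lt.
by rewrite cardsU1; case: (_ \notin _); rewrite ?add1n ?add0n // ltnW.
Qed.

(** Conflicting vertices are joined through a common low vertex of their supports, and low vertices
    have closed neighbourhoods of size at most [D]. Excluding high vertices from [same_out] is what
    bounds this dependency degree. *)
Lemma card_conflict v : #|[set u | conflict v u]| <= D * D.
Proof.
have [vH|vH] := boolP (v \in high G D).
  rewrite (_ : [set u | _] = finset.set0) ?cards0 //.
  by apply/setP => u; rewrite !inE /conflict vH.
apply: (@leq_trans (\sum_(x in v |: nbhd G v | x \notin high G D) #|x |: nbhd G x|)).
  apply: (@leq_trans #|\bigcup_(x in v |: nbhd G v | x \notin high G D) (x |: nbhd G x)|).
    apply/subset_leq_card/fintype.subsetP => u; rewrite inE => /and4P[_ uH _].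
    rewrite -setI_eq0 => /set0Pn[x /setIP[xv xu]].
    apply/bigcupP; exists x.
      rewrite (support_low vH xv) andbT; move: xv => /setU1P[->|]; first exact: setU11.
      by rewrite inE => /and3P[Gvx _ _]; rewrite !inE Gvx orbT.
    move: xu => /setU1P[->|]; first exact: setU11.
    by rewrite inE => /and3P[Gux _ _]; rewrite !inE adj_sym Gux orbT.
  elim/big_rec2: _ => [|x a A _ le]; rewrite ?cards0 //.
  by rewrite (leq_trans (leq_card_setU _ _)) // leq_add2l.
apply: (@leq_trans (\sum_(x in v |: nbhd G v) D)).
  rewrite big_mkcondr; apply: leq_sum => x _; case: ifP => // xH.
  exact: card_closed_nbhd.
by rewrite sum_nat_const leq_mul2r card_closed_nbhd ?orbT.
Qed.

Lemma conflict_coloring : exists col : 'I_n -> nat,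
  (forall v, col v < (D * D).+1) /\ (forall u v, conflict u v -> col u != col v).
Proof.
have [v _|col [lt neq]] := @greedy_coloring _ conflict val conflict_sym val_inj (D * D) [set: 'I_n].
  apply: leq_trans (card_conflict v); apply/subset_leq_card/fintype.subsetP => u.
  by rewrite /out_nbhd !inE /= => /andP[].
exists col; split=> [v|u v cuv]; first by apply: lt; rewrite inE.
apply: neq; rewrite ?inE //; by case/and4P: cuv.
Qed.

Local Open Scope ring_scope.

Lemma prob_crowded1 j v theta (t : R) : (j <= Q)%N -> 0 <= theta -> t <= T.+1%:R ->
  prob R (fun s : seeds => (T < #|same_out G s sigma D j v| * 2 ^ j)%N) <=
  expR ((kappa%:R * (expR theta - 1) - theta * t) / 2 ^+ j).
Proof.
move=> jQ t0 leT.
have p2 : 0 < 2 ^+ j :> R by rewrite exprn_gt0.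
have eth : 0 <= expR theta - 1 by rewrite subr_ge0 -[X in X <= _]expR0 ler_expR.
apply: le_trans (prob_imply R (F := fun s : seeds =>
  t / 2 ^+ j <= #|same_out G s sigma D j v|%:R :> R) _) _.
  move=> s lt /=; rewrite ler_pdivrMr //; apply: le_trans leT _.
  by rewrite -natrX -natrM ler_nat.
apply: (@le_trans _ _ (expR (kappa%:R * ((expR theta - 1) / 2 ^+ j)
                             - theta * (t / 2 ^+ j)))); last first.
  by rewrite ler_expR le_eqVlt; apply/orP; left; apply/eqP; ring.
apply: prob_chernoff => //; under eq_mean do rewrite same_outE.
apply: le_trans (mean_expR_same jQ t0 (low_out_self v)) _.
rewrite ler_expR; apply: ler_wpM2r; first by rewrite divr_ge0 // ltW.
by rewrite ler_nat card_low_out.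
Qed.

Lemma prob_crowded_exists j p : (forall v,
    prob R (fun s : seeds => (T < #|same_out G s sigma D j v| * 2 ^ j)%N) <= p) ->
  prob R (fun s : seeds => (0 < #|crowded G s sigma D T j|)%N) <= n%:R * p.
Proof.
move=> le; rewrite -[X in X%:R * _]card_ord.
apply: le_trans (prob_exists (E := fun v (s : seeds) => v \in crowded G s sigma D T j) _).
  by apply: prob_imply => s /card_gt0P[v vc]; apply/existsP; exists v.
move=> v; apply: le_trans (le v); apply: prob_imply => s.
by rewrite inE => /andP[].
Qed.

Lemma crowded_depends j v : depends_on (support v)
  (fun s : seeds => expR (1 * (v \in crowded G s sigma D T j)%:R) : R).
Proof.
move=> s s' es; congr (expR (_ * _%:R)); rewrite !inE; congr (_ && (_ < #|pred_of_set _| * _)%N).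
rewrite !same_outE; apply/setP => u; rewrite [LHS]inE [RHS]inE.
case uU: (u \in low_out v) => //=.
have uS : u \in support v by apply/setU1P; right.
by rewrite (es u uS) (es v (setU11 _ _)).
Qed.

(** A coloring of the conflict graph splits the low vertices into [Dl] classes of events with
    disjoint supports. If too many vertices are crowded, then some class has an average share
    [n / (D * Dl)] of them, and Chernoff applies inside that class. *)
Lemma prob_crowded_many j p (Dl := (D * D).+1) : (0 < D)%N -> 0 <= p -> (forall v,
    prob R (fun s : seeds => (T < #|same_out G s sigma D j v| * 2 ^ j)%N) <= p) ->
  prob R (fun s : seeds => (n %/ D < #|crowded G s sigma D T j|)%N) <=
  Dl%:R * expR (3 * p * n%:R - n%:R / (D * Dl)%:R).
Proof.
move=> D_gt0 p0 le.
have [col [lt neq]] := conflict_coloring.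
pose Z (q : 'I_Dl) : {set 'I_n} := [set v | (v \notin high G D) && (col v == q)].
pose a : R := n%:R / (D * Dl)%:R.
pose X q (s : seeds) : R := #|[set v | (v \in Z q) && (v \in crowded G s sigma D T j)]|%:R.
have card_crowded s : #|crowded G s sigma D T j|%:R = \sum_q X q s :> R.
  rewrite /X -natr_sum; congr (_%:R).
  rewrite -sum1_card (partition_big (fun v => Ordinal (lt v)) predT) //=.
  apply: eq_bigr => q _; rewrite -sum1dep_card; apply: eq_bigl => v.
  by rewrite !inE -val_eqE /=; case: (_ <= _)%N; case: (T < _)%N; case: (_ == _ :> nat).
apply: le_trans (prob_imply R (F := fun s : seeds => [exists q, a <= X q s]) _) _.
  move=> s; apply: contraTT => /existsPn small; rewrite -leqNgt leq_divRL //.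
  rewrite -(ler_nat R) natrM card_crowded.
  have nz k : (0 < k)%N -> k%:R != 0 :> R by rewrite pnatr_eq0 -lt0n.
  have -> : n%:R = Dl%:R * a * D%:R :> R.
    by rewrite /a natrM; field; rewrite !nz.
  apply: ler_wpM2r => //; rewrite -[X in X%:R * _](card_ord Dl) mulr_natl -sumr_const.
  by apply: ler_sum => q _; rewrite ltW // ltNge; apply: small.
have := @prob_exists R _ 'I_Dl (fun q s => a <= X q s) (expR (3 * p * n%:R - a)).
rewrite card_ord; apply=> q; rewrite -[X in expR (_ - X)]mul1r.
apply: prob_chernoff; first exact: ler01.
rewrite /X; under eq_mean do rewrite expR_card.
have dep v : v \in enum (Z q) -> depends_on (support v)
    (fun s : seeds => expR (1 * (v \in crowded G s sigma D T j)%:R) : R).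
  by move=> _; apply: crowded_depends.
rewrite (@eq_mean _ _ _ (fun s : seeds => \prod_(v <- enum (Z q))
    expR (1 * (v \in crowded G s sigma D T j)%:R))); last first.
  move=> s; rewrite big_enum /= [RHS]big_mkcond; apply: eq_bigr => v _.
  by case: (v \in Z q) => //=; rewrite mulr0 expR0.
rewrite (mean_prod_indep (card_seeds_gt0 _ _) (enum_uniq _) dep); last first.
  move=> u v; rewrite !mem_enum !inE => /andP[uH /eqP cu] /andP[vH /eqP cv] uv.
  apply: contraTT isT => ndis; have := neq u v; rewrite /conflict !inE uH vH uv ndis.
  by move=> /(_ isT); rewrite cu cv eqxx.
apply: (@le_trans _ _ (\prod_(v <- enum (Z q)) expR (3 * p))).
  apply: ler_prod => v _; apply/andP; split.
    by rewrite mulr_ge0 ?invr_ge0 ?ler0n // sumr_ge0 // => x _; apply: expR_ge0.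
  apply: le_trans (mean_expR_bool (card_seeds_gt0 _ _) ler01 (_ : _ <= p)) _.
    by apply: le_trans (le v); apply: prob_imply => s; rewrite inE => /andP[].
  rewrite ler_expR ler_wpM2r //; have := expR1_le4 R; lra.
rewrite big_enum /= prodr_const -expRM_natr ler_expR ler_wpM2l ?mulr_ge0 //.
by rewrite ler_nat -[X in (_ <= X)%N]card_ord max_card.
Qed.

End Crowding.

(** * The two regimes of the degeneracy *)

Lemma expR_dominates (R : realType) (C : R) k :
  exists2 h0 : R, (1 <= h0)%R & forall h, (h0 <= h)%R -> (C * h ^+ k <= expR h)%R.
Proof.
pose h0 : R := Num.max 1%R (C * k.+1`!%:R)%R.
exists h0; first by rewrite le_max lexx.
move=> h; rewrite ge_max => /andP[h1 hC]; have h_ge0 := le_trans ler01 h1.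
apply: le_trans (le_trans _ (expR_ge1Dxn k h_ge0)) (lexx _).
have f0 : (0 < k.+1`!%:R :> R)%R by rewrite ltr0n fact_gt0.
apply: le_trans (_ : h ^+ k.+1 / k.+1`!%:R <= _)%R; last by rewrite lerDr.
by rewrite ler_pdivlMr // mulrAC exprS ler_wpM2r // exprn_ge0.
Qed.

(** [H] high vertices span at most [k * H] edges, which is [O(n)] once [D >= k ^ 2]; for
    [k <= lg ^ 2] this explains the choice [D = lg ^ 4]. *)
Lemma high_load k H D n : 0 < D -> k * k <= D -> H * D <= 2 * (k * n) ->
  2 * (k * H) <= 34 * n.
Proof.
move=> D0 kD HD; rewrite -(leq_pmul2r D0).
have e1 : 2 * (k * H) * D = 2 * k * (H * D) by rewrite !mulnA.
have e2 : 2 * k * (2 * (k * n)) = 4 * n * (k * k) by nia.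
rewrite e1; apply: (@leq_trans (4 * n * (k * k))); first by rewrite -e2 leq_mul2l HD orbT.
by apply: leq_mul => //; rewrite leq_mul2r orbT.
Qed.

(** The [x.+1] leaders leave at most [n / lg ^ 4] vertices each, and
    [lg ^ 2 * (4 * lg) * n / lg ^ 4] is still linear. *)
Lemma rest_load k x lg n : 0 < lg -> k <= lg ^ 2 -> x <= 3 * lg ->
  2 * (k * (x.+1 * (n %/ lg ^ 4))) <= 34 * n.
Proof.
move=> lg0 kl xl; have leD := leq_trunc_div n (lg ^ 4).
apply: (@leq_trans (34 * (n %/ lg ^ 4 * lg ^ 4))); last by rewrite leq_mul2l.
set tau := n %/ _ in leD *.
have le1 : x.+1 <= 4 * lg by lia.
have le2 : k * x.+1 <= lg ^ 2 * (4 * lg) by apply: leq_mul.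
have le3 : lg ^ 2 * lg <= lg ^ 4 by rewrite -expnSr [X in _ <= X]expnSr leq_pmulr.
have e1 : 2 * (k * (x.+1 * tau)) = 2 * tau * (k * x.+1) by rewrite !mulnA mulnC !mulnA; nia.
rewrite e1; apply: (@leq_trans (2 * tau * (4 * lg ^ 4))); last by nia.
rewrite leq_mul2l; apply/orP; right; apply: leq_trans le2 _; nia.
Qed.

Section Regimes.
Variables (R : realType) (m Q : nat).
Local Notation n := m.+1.
Variables (G : sgraph n) (sigma : 'I_n -> nat) (kappa : nat).
Hypothesis sigma_inj : injective sigma.
Hypothesis out_kappa : forall v, #|out_nbhd G sigma [set: 'I_n] v| <= kappa.
Hypothesis leQ : 2 ^ Q <= m.
Hypothesis gtQ : m < 2 ^ Q.+1.
Hypothesis kappa_n : kappa <= n.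
Local Notation seeds := (seeds n Q).
Local Open Scope ring_scope.

Definition colors_within D B : pred seeds :=
  fun s => success 34 D (G, s) && (palette 34 D (G, s) <= B)%N.

(** Union bound over the [j0.+1] levels and the [2 ^ j0] blocks; each of these numbers is at most
    [n]. *)
Lemma prob_colors_within D T j0 (p : R) :
  (2 * (kappa * #|high G D|) <= 34 * n)%N ->
  (2 * (kappa * ((2 ^ j0).+1 * (n %/ D))) <= 34 * n)%N ->
  (T < 4 ^ j0.+1)%N -> (j0 <= Q)%N ->
  (forall j, (j <= j0)%N ->
    prob R (fun s : seeds => (n %/ D < #|crowded G s sigma D T j|)%N) <= p) ->
  expR (- (n%:R / 2 ^+ j0)) <= p ->
  prob R (fun s => ~~ colors_within D
     (T + 2 ^ j0 + (if high G D == finset.set0 then 0 else kappa.+1)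
                   + (if n %/ D == 0 then 0 else kappa.+1))%N s) <= 2 * n%:R * p.
Proof.
move=> h1 h2 h3 j0Q le1 le2.
have lej : (2 ^ j0 <= n)%N.
  by rewrite ltnW // ltnS (leq_trans _ leQ) // leq_exp2l.
have p0 : 0 <= p := le_trans (expR_ge0 _) le2.
apply: le_trans (prob_imply R (F := fun s : seeds =>
   [exists j : 'I_j0.+1, (n %/ D < #|crowded G s sigma D T j|)%N] ||
   [exists t : j0.-tuple bool, (4 * n < #|[set v | take j0 (s v) == t]| * 2 ^ j0)%N]) _) _.
  move=> s; apply: contraR; rewrite negb_or => /andP[/existsPn c1 /existsPn c2].
  rewrite /colors_within; apply/andP.
  apply: (@palette_bound _ _ _ _ _ _ sigma_inj out_kappa leQ D T j0 _ _ h1 h2 h3 j0Q) => [j lej0|z].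
    by rewrite leqNgt; have := c1 (Ordinal (lej0 : (j < j0.+1)%N)).
  have [/eqP sz|sz] := boolP (size z == j0).
    by have := c2 (tcast sz (in_tuple z)); rewrite -leqNgt val_tcast.
  rewrite (_ : [set v | _] = finset.set0) ?cards0 //; apply/setP => v; rewrite !inE.
  apply/negP => /eqP e; case/negP: sz; rewrite -e size_takel // size_tuple //.
apply: le_trans (prob_or R _ _) _.
have -> : 2 * n%:R * p = n%:R * p + n%:R * p by ring.
apply: lerD.
  apply: le_trans (prob_exists (E := fun (j : 'I_j0.+1) (s : seeds) =>
     (n %/ D < #|crowded G s sigma D T j|)%N) (p := p) _) _.
    by move=> j; apply: le1; rewrite -ltnS.
  rewrite card_ord; apply: ler_wpM2r => //; rewrite ler_nat.
  exact: leq_trans (ltn_expl _ _) lej.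
apply: le_trans (prob_block_large R n j0Q) _.
apply: ler_pM => //; rewrite ?exprn_ge0 ?expR_ge0 //.
by rewrite -natrX ler_nat.
Qed.

(** Selects the level with [2 ^ j0] about [sqrt t], where a block has [O(n)] edges. *)
Lemma trunc_log4 (t : R) : 1 <= t -> exists T j0 : nat,
  [/\ T%:R <= t, t < T.+1%:R, (T < 4 ^ j0.+1)%N & (2 ^+ j0) ^+ 2 <= t].
Proof.
move=> t1; have t0 : 0 <= t := le_trans ler01 t1.
exists (Num.truncn t), (trunc_log 4 (Num.truncn t)).
have /andP[le lt] := truncn_itv t0.
have T1 : (0 < Num.truncn t)%N by rewrite truncn_gt0.
split=> //; first exact: trunc_log_ltn.
apply: le_trans le; rewrite -exprM mulnC exprM (_ : 2 ^+ 2 = 4%:R); last by rewrite -natrX.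
by rewrite -natrX ler_nat trunc_logP.
Qed.

(** Otherwise [n <= 2 ^ j0], so [n ^ 2 <= 81 * n]. *)
Lemma level_fits j0 : ((2 ^+ j0) ^+ 2 <= 81 * n%:R :> R) -> (83 <= n)%N -> (j0 <= Q)%N.
Proof.
rewrite -!natrX -natrM ler_nat => le le83; rewrite leqNgt; apply/negP => lt.
have : (2 ^ Q.+1 <= 2 ^ j0)%N by rewrite leq_exp2l.
move=> le2; have lem : (m < 2 ^ j0)%N by apply: leq_trans gtQ le2.
move: le lem le83; set x := (2 ^ j0)%N; rewrite -mulnn => le lem le83; nia.
Qed.


Local Notation L := (ln n%:R : R).

Let nE : n%:R = expR L.
Proof. by rewrite lnK // posrE ltr0n. Qed.

Let square_root_mono (x y : R) : 0 <= y -> x ^+ 2 <= y ^+ 2 -> x <= y.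
Proof.
move=> y0 le; have [x0|/ltW x0] := leP 0 x; last exact: le_trans x0 y0.
by rewrite -(@ler_pXn2r _ 2) ?nnegrE.
Qed.

Let block_tail (q : R) : 0 < q -> q ^+ 2 <= 81 * n%:R -> 0 <= L -> (100 * L) ^+ 2 <= n%:R ->
  expR (- (n%:R / q)) <= expR (- (3 * L)).
Proof.
move=> q0 qn L0 big; rewrite ler_expR lerN2 ler_pdivlMr //.
apply: square_root_mono; first exact: ler0n.
have n0 : 0 <= n%:R :> R by [].
(* Since [729 = 9 * 81], this gives [(3 * L * q) ^ 2 <= n ^ 2]. *)
have leL : L ^+ 2 <= n%:R / 729 by move: big; rewrite exprMn; have := sqr_ge0 L; lra.
have : L ^+ 2 * q ^+ 2 <= n%:R / 729 * (81 * n%:R).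
  by apply: ler_pM; rewrite ?exprn_ge0 ?(ltW q0).
rewrite exprMn exprMn => le.
have : n%:R * n%:R >= 0 :> R by rewrite mulr_ge0.
by rewrite expr2; lra.
Qed.

Let failure_total : (2 <= n)%N -> 2 * n%:R * expR (- (3 * L)) <= n%:R^-1.
Proof.
move=> n2; have n0 : 0 < n%:R :> R by rewrite ltr0n.
have -> : expR (- (3 * L)) = n%:R^-1 ^+ 3.
  by rewrite mulrC expRN expRM_natr -nE exprVn.
have -> : 2 * n%:R * n%:R^-1 ^+ 3 = (2 / n%:R) * n%:R^-1 :> R.
  by field; rewrite lt0r_neq0.
rewrite -[X in _ <= X]mul1r ler_pM2r ?invr_gt0 // ler_pdivrMr // mul1r.
by rewrite (ler_nat R 2).
Qed.

(** The roots [a] and [l] make all estimates polynomial; [l <= a] means [ln^2 n <= kappa]. *)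
Lemma degeneracy_large (a l : R) : a ^+ 4 = kappa%:R -> l ^+ 2 = L ->
  1 <= l -> l <= a -> (83 <= n)%N -> (100 * L) ^+ 2 <= n%:R ->
  exists2 B : nat, B%:R <= kappa%:R + 89 * a ^+ 3 * l &
    prob R (fun s => ~~ colors_within n.+1 B s) <= n%:R^-1.
Proof.
move=> aE lE l1 la n83 big.
have a1 : 1 <= a := le_trans l1 la.
have a0 : 0 < a := lt_le_trans ltr01 a1.
have l0 : 0 < l := lt_le_trans ltr01 l1.
have L0 : 0 <= L by rewrite -lE exprn_ge0 // ltW.
(* Then [t <= 81 * a ^ 4], so [2 ^ j0 <= 9 * a ^ 2 <= 9 * a ^ 3 * l], and [89 = 80 + 9]. *)
pose t := a ^+ 4 + 80 * a ^+ 3 * l.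
have a3l : a ^+ 3 * l <= a ^+ 4.
  by rewrite [X in _ <= X]exprSr ler_pM2l // exprn_gt0.
have a3l0 : 0 <= a ^+ 3 * l by rewrite mulr_ge0 ?exprn_ge0 ?ltW.
have a4_1 : 1 <= a ^+ 4 by rewrite exprn_ege1.
have t1 : 1 <= t by rewrite /t; lra.
have [T [j0 [leT ltT ltT4 q2]]] := trunc_log4 t1.
set q := 2 ^+ j0 in q2.
have q0 : 0 < q by rewrite exprn_gt0.
have qa : q <= 9 * a ^+ 2.
  apply: square_root_mono; first by rewrite mulr_ge0 // exprn_ge0 // ltW.
  by apply: le_trans q2 _; rewrite exprMn -exprM /t; lra.
have qn : q ^+ 2 <= 81 * n%:R.
  apply: le_trans q2 _; apply: (@le_trans _ _ (81 * a ^+ 4)); first by rewrite /t; lra.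
  by rewrite aE ler_pM2l // ler_nat.
have j0Q : (j0 <= Q)%N by apply: level_fits n83.
have H0 : high G n.+1 = finset.set0.
  apply/setP => v; rewrite !inE; apply/negbTE; rewrite -ltnNge ltnS.
  by rewrite -[X in (_ <= X)%N]card_ord max_card.
have tau0 : (n %/ n.+1 = 0)%N by rewrite divn_small.
exists (T + 2 ^ j0)%N.
  rewrite natrD natrX -/q -aE.
  have : a ^+ 2 <= a ^+ 3 * l.
    have -> : a ^+ 3 * l = a ^+ 2 * (a * l) by ring.
    by rewrite ler_peMr ?exprn_ge0 ?mulr_ege1 // ltW.
  by move: leT; rewrite /t; lra.
apply: le_trans (failure_total (leq_trans _ n83)); last by [].
have := @prob_colors_within n.+1 T j0 (expR (- (3 * L))).
rewrite H0 eqxx tau0 cards0 !muln0 !addn0; apply=> //; last exact: block_tail.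
move=> j lej; have -> : expR (- (3 * L)) = n%:R * expR (- (4 * L)).
  by rewrite [X in _ = X * _]nE -expRD; congr expR; ring.
apply: prob_crowded_exists => v.
(* At most [1/2] as [expR_le_quad] requires. The numerator of the exponent becomes at most
   [- 36 * a ^ 2 * L], and division by [2 ^ j <= 9 * a ^ 2] leaves [- 4 * L], which survives the
   union bound over vertices. *)
pose th := l / (2 * a).
have th0 : 0 <= th by rewrite divr_ge0 ?mulr_ge0 ?ltW.
have th2 : th <= 2^-1 by rewrite /th ler_pdivrMr ?mulr_gt0 //; lra.
have tha : th * a = l / 2 by rewrite /th; field; rewrite lt0r_neq0.
apply: le_trans (@prob_crowded1 R m Q G sigma kappa out_kappa n.+1 T j v th t _ th0 (ltW ltT)) _.
  exact: leq_trans lej j0Q.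
rewrite ler_expR.
have num : kappa%:R * (expR th - 1) - th * t <= - (36 * (a ^+ 2 * L)).
  have : kappa%:R * (expR th - 1) <= kappa%:R * (th + 2 * th ^+ 2).
    by apply: ler_wpM2l => //; have := @expR_le_quad R th; rewrite th0 th2 => /(_ isT); lra.
  rewrite -aE => le; apply: le_trans (lerB le (lexx _)) _.
  have -> : a ^+ 4 * (th + 2 * th ^+ 2) - th * t =
      2 * a ^+ 2 * (th * a) ^+ 2 - 80 * (th * a) * a ^+ 2 * l.
    by rewrite /t; ring.
  rewrite tha -lE; have : 0 <= a ^+ 2 * l ^+ 2 by rewrite mulr_ge0 ?exprn_ge0 ?ltW.
  have -> : 2 * a ^+ 2 * (l / 2) ^+ 2 - 80 * (l / 2) * a ^+ 2 * l = - (79 / 2 * (a ^+ 2 * l ^+ 2)).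
    by field.
  by lra.
have p2 : 0 < 2 ^+ j :> R by rewrite exprn_gt0.
rewrite ler_pdivrMr //; apply: le_trans num _.
rewrite mulNr lerN2.
have : 2 ^+ j <= 9 * a ^+ 2.
  by apply: le_trans qa; rewrite /q -!natrX ler_nat leq_exp2l.
move=> le; apply: le_trans (_ : 4 * L * (9 * a ^+ 2) <= _).
  by apply: ler_wpM2l => //; rewrite mulr_ge0.
by rewrite le_eqVlt; apply/orP; left; apply/eqP; ring.
Qed.

Lemma card_high D : (#|high G D| * D <= 2 * (kappa * n))%N.
Proof.
rewrite -sum_nat_const.
apply: (@leq_trans (\sum_(v in [set: 'I_n]) #|[set u in [set: 'I_n] | G v u]|)).
  rewrite big_mkcond [X in (_ <= X)%N]big_mkcond; apply: leq_sum => v _; rewrite !inE.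
  by case: ifP => // /leq_trans -> //; apply/subset_leq_card/fintype.subsetP => u; rewrite !inE.
rewrite (sum_nbhd_out (@adj_sym _ G) sigma_inj _ (@adj_irr _ G)) leq_mul2l /=.
apply: (@leq_trans (\sum_(v in [set: 'I_n]) kappa)%N).
  by apply: leq_sum => v _.
by rewrite sum_nat_const cardsT card_ord mulnC.
Qed.

Lemma degeneracy_small (a l h : R) lg (D := (lg ^ 4)%N) :
  a ^+ 4 = kappa%:R -> l ^+ 2 = L -> h ^+ 2 = l -> 1 <= h -> 1 <= a -> a <= l ->
  (83 <= n)%N -> (100 * L) ^+ 2 <= n%:R -> L <= lg%:R ->
  12 * D%:R ^+ 3 <= expR h -> 16 * L * D%:R ^+ 3 <= n%:R ->
  2 * D%:R ^+ 2 <= n%:R :> R ->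
  exists2 B : nat, B%:R <= kappa%:R + 89 * a ^+ 3 * l &
    prob R (fun s => ~~ colors_within D B s) <= n%:R^-1.
Proof.
move=> aE lE hE h1 a1 al n83 big Llg bigp bign bigD.
have h0 : 0 < h := lt_le_trans ltr01 h1.
have a0 : 0 < a := lt_le_trans ltr01 a1.
have l1 : 1 <= l := le_trans a1 al.
have l0 : 0 < l := lt_le_trans ltr01 l1.
have L1 : 1 <= L by rewrite -lE exprn_ege1.
have L0 : 0 <= L := le_trans ler01 L1.
have lg_gt0 : (0 < lg)%N by rewrite -(ltr_nat R); apply: lt_le_trans Llg; lra.
have D_gt0 : (0 < D)%N by rewrite expn_gt0 lg_gt0.
have a4l : a ^+ 4 <= L ^+ 2.
  by rewrite -lE -exprM; apply: lerXn2r; rewrite ?nnegrE ?(ltW a0) ?(ltW l0).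
have k_lg : (kappa <= lg ^ 2)%N.
  rewrite -(ler_nat R) -aE natrX; apply: le_trans a4l _.
  by apply: lerXn2r; rewrite ?nnegrE.
(* With 6, [kappa * (e - 1) <= 3 * a ^ 4 <= t / 2], so [theta = 1] leaves [- t / 2] in the numerator
   of the Chernoff exponent. *)
pose t := 6 * (a ^+ 3 * l).
have a4t : a ^+ 4 <= a ^+ 3 * l by rewrite [X in X <= _]exprSr ler_pM2l // exprn_gt0.
have a3_1 : 1 <= a ^+ 3 by rewrite exprn_ege1.
have lle : l <= a ^+ 3 * l by rewrite ler_peMl // ltW.
have t1 : 1 <= t by rewrite /t; lra.
have tL : t <= 6 * L ^+ 2.
  rewrite /t ler_pM2l // -lE -exprM [X in _ <= X]exprSr ler_pM2r //.
  by apply: lerXn2r; rewrite ?nnegrE ?(ltW a0) ?(ltW l0).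
have [T [j0 [leT ltT ltT4 q2]]] := trunc_log4 t1.
have q_lg : (2 ^ j0 <= 3 * lg)%N.
  rewrite -(ler_nat R) natrX natrM; apply: square_root_mono; first by rewrite mulr_ge0.
  apply: le_trans q2 (le_trans tL _); rewrite exprMn.
  have : L ^+ 2 <= lg%:R ^+ 2 by apply: lerXn2r; rewrite ?nnegrE.
  have := sqr_ge0 (lg%:R : R); lra.
have qt : 2 ^+ j0 <= t :> R.
  by apply: le_trans q2; rewrite expr2 ler_peMl ?exprn_ge0 ?exprn_ege1 // ler1n.
move: q2 qt; set q := 2 ^+ j0 => q2 qt.
have q0 : 0 < q by rewrite exprn_gt0.
have qn : q ^+ 2 <= 81 * n%:R.
  apply: le_trans q2 (le_trans tL _); move: big; rewrite exprMn; have := sqr_ge0 L; lra.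
have j0Q : (j0 <= Q)%N by apply: level_fits n83.
pose B := (T + 2 ^ j0 + (if high G D == finset.set0 then 0 else kappa.+1)
                   + (if n %/ D == 0 then 0 else kappa.+1))%N.
exists B.
  have : (B <= T + 2 ^ j0 + kappa.+1 + kappa.+1)%N.
    by rewrite /B leq_add // ?leq_add //; case: ifP.
  rewrite -(ler_nat R) => leB; apply: le_trans leB _.
  rewrite !natrD natrX -/q -[kappa.+1%:R]natr1 -aE.
  by move: leT qt; rewrite /t; lra.
apply: le_trans (failure_total (leq_trans _ n83)); last by [].
apply: prob_colors_within => //; last exact: block_tail.
- by apply: high_load D_gt0 _ (card_high D); rewrite /D (expnD lg 2 2) leq_mul.
- exact: rest_load.
move=> j lej.
(* As [(h * q) ^ 2 <= l * t <= (t / 2) ^ 2], a vertex is crowded with probability at most [p]. Here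
   [h] is only the fourth root of [ln n]: [p] beats powers of [D] but not [1 / n], hence the
   concentration argument. *)
pose p := expR (- h).
apply: le_trans (@prob_crowded_many R m Q G sigma D T j p D_gt0 (expR_ge0 _) _) _.
  move=> v.
  apply: le_trans (@prob_crowded1 R m Q G sigma kappa out_kappa D T j v 1 t _ ler01 (ltW ltT)) _.
    exact: leq_trans lej j0Q.
  have p2 : 0 < 2 ^+ j :> R by rewrite exprn_gt0.
  have pq : 2 ^+ j <= q by rewrite /q -!natrX ler_nat leq_exp2l.
  rewrite ler_expR ler_pdivrMr // mulNr mul1r.
  apply: (@le_trans _ _ (- (t / 2))).
    have : kappa%:R * (expR 1 - 1) <= kappa%:R * 3 :> R.
      by apply: ler_wpM2l => //; have := expR1_le4 R; lra.
    rewrite -aE /t; lra.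
  rewrite lerN2; apply: le_trans (_ : h * q <= _); first by rewrite ler_pM2l.
  apply: square_root_mono; first by lra.
  rewrite exprMn hE; apply: (@le_trans _ _ (l * t)); first by rewrite ler_pM2l.
  rewrite [X in _ <= X]expr2; have : l * t <= t / 6 * t by rewrite ler_pM2r ?/t; lra.
  have : 0 <= t * t by rewrite mulr_ge0 //; lra.
  by lra.
have Dr : 1 <= D%:R :> R by rewrite ler1n.
have D0 : 0 < D%:R :> R by rewrite ltr0n.
have D3 : 0 < D%:R ^+ 3 :> R by rewrite exprn_gt0.
have leDl : ((D * D).+1%:R <= 2 * D%:R ^+ 2 :> R).
  by rewrite -natr1 natrM expr2; have := @mulr_ege1 R _ _ Dr Dr; lra.
have Dl0 : 0 < (D * D).+1%:R :> R by rewrite ltr0n.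
apply: (@le_trans _ _ (expR L * expR (- (4 * L)))); last first.
  by rewrite -expRD ler_expR; lra.
apply: ler_pM; rewrite ?expR_ge0 ?ler0n //; first by rewrite -nE (le_trans leDl).
rewrite ler_expR.
have n0 : 0 < n%:R :> R by rewrite ltr0n.
(* The expected count uses up at most half of the allowed [n / (2 * D ^ 3)]; the other half still
   exceeds [4 * L]. *)
have lep : 3 * p * n%:R <= n%:R / (4 * D%:R ^+ 3).
  rewrite [X in _ <= X]mulrC ler_pM2r // /p expRN.
  rewrite -[X in _ <= X]mul1r ler_pdivlMr ?mulr_gt0 // mulrAC ler_pdivrMr ?expR_gt0 //.
  by lra.
have leV : n%:R / (2 * D%:R ^+ 3) <= n%:R / (D * (D * D).+1)%:R :> R.
  have DDl : (D * (D * D).+1)%:R <= 2 * D%:R ^+ 3 :> R.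
    have -> : 2 * D%:R ^+ 3 = D%:R * (2 * D%:R ^+ 2) :> R by ring.
    by rewrite natrM ler_pM2l.
  rewrite ler_pM2l // lef_pV2 // posrE; first by rewrite mulr_gt0.
  by rewrite ltr0n muln_gt0 D_gt0.
have bigL : 4 * L <= n%:R / (4 * D%:R ^+ 3).
  by rewrite ler_pdivlMr ?mulr_gt0 //; lra.
have e2 : n%:R / (2 * D%:R ^+ 3) = n%:R / (4 * D%:R ^+ 3) + n%:R / (4 * D%:R ^+ 3) :> R.
  by field; rewrite lt0r_neq0.
apply: le_trans (lerB lep leV) _.
by rewrite e2 opprD addrA subrr add0r lerN2.
Qed.

End Regimes.

(** * Asymptotics *)

Lemma proper_coloring_mono n (G : sgraph n) k k' col :
  k <= k' -> proper_coloring G k col -> proper_coloring G k' col.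
Proof.
move=> le /andP[/forallP lt neq]; apply/andP; split=> //.
by apply/forallP => v; apply: leq_trans le.
Qed.

Lemma degeneracy_le n (G : sgraph n) : degeneracy G <= n.
Proof.
rewrite /degeneracy; case: ex_minnP => k _; apply.
apply/forallP => S; apply/implyP => /set0Pn[v vS]; apply/existsP; exists v.
by rewrite vS /= (leq_trans (max_card _)) ?card_ord.
Qed.

Lemma better_proper m Q (G : sgraph m.+1) (s : seeds m.+1 Q) D D' B k :
  colors_within G D B s || colors_within G D' B s -> B <= k ->
  proper_coloring G k (color 34 (better 34 D D' (G, s)) (G, s)).
Proof.
move=> wi leB; have sb : success 34 (better 34 D D' (G, s)) (G, s).
  by apply: better_success; case/orP: wi => /andP[-> _]; rewrite ?orbT.
apply: proper_coloring_mono (color_proper sb); apply: leq_trans leB.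
case/orP: wi => /andP[sD leD]; apply: leq_trans leD.
  exact: better_palettel.
exact: better_paletter.
Qed.

(** Both regimes assume [a >= 1], so [kappa = 0] is separate: nothing is crowded, and [T = j0 = 0]
    yields one color for every seed. *)
Lemma edgeless_colors m Q (G : sgraph m.+1) (s : seeds m.+1 Q) :
  2 ^ Q <= m -> degeneracy G = 0 -> colors_within G m.+2 1 s.
Proof.
move=> leQ k0; have [sigma sigma_inj out0] := degeneracy_order G; rewrite k0 in out0.
have tau0 : m.+1 %/ m.+2 = 0 by rewrite divn_small.
have H0 : high G m.+2 = finset.set0.
  apply/setP => v; rewrite !inE; apply/negbTE; rewrite -ltnNge ltnS.
  by rewrite -[X in _ <= X]card_ord max_card.
have := @palette_bound m Q G s sigma 0 sigma_inj out0 leQ m.+2 0 0.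
rewrite H0 eqxx tau0 eqxx !add0n !addn0 expn0 => pb; apply/andP; apply: pb => //.
- move=> j _; rewrite leqn0 cards_eq0; apply/eqP/setP => v; rewrite !inE.
  apply/negbTE; rewrite negb_and; apply/orP; right; rewrite -leqNgt leqn0 muln_eq0 cards_eq0.
  apply/orP; left; apply/eqP/setP => u; rewrite !inE; apply/negbTE/negP.
  case/and4P => Gvu lt _ _; have := out0 v; rewrite leqn0 cards_eq0 => /eqP/setP/(_ u).
  by rewrite !inE Gvu lt.
- move=> z; rewrite muln1 (leq_trans (max_card _)) // card_ord leq_pmull //.
Qed.

Section Asymptotics.
Variable R : realType.
Local Open Scope ring_scope.

Lemma powR_nat_root (x : R) (k : nat) : 0 <= x -> (0 < k)%N -> (x `^ k%:R^-1) ^+ k = x.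
Proof.
move=> x0 k0; rewrite -powR_mulrn ?powR_ge0 // -powRrM mulVf ?powRr1 //.
by rewrite pnatr_eq0 -lt0n.
Qed.

Lemma powR_frac (x : R) (i k : nat) : 0 <= x -> x `^ (i%:R / k%:R) = (x `^ k%:R^-1) ^+ i.
Proof.
by move=> x0; rewrite -powR_mulrn ?powR_ge0 // -powRrM mulrC.
Qed.

Lemma ln2_bounds : 2^-1 <= ln (2 : R) <= 1.
Proof.
apply/andP; split.
  rewrite -(@ler_pM2l _ 2) // mulfV // mulrC mulr_natr -lnXn //.
  rewrite -ler_expR lnK ?posrE ?exprn_gt0 //.
  by apply: le_trans (expR1_le4 R) _; rewrite expr2; lra.
by rewrite -ler_expR lnK ?posrE //; apply: le_trans (expR_ge1Dx _); lra.
Qed.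

Lemma log_bounds n : (0 < n)%N -> ln n%:R <= (trunc_log 2 n).+1%:R :> R /\
  (trunc_log 2 n)%:R <= 2 * ln n%:R :> R.
Proof.
move=> n0; have /andP[l2 l1] := ln2_bounds; have npos : 0 < n%:R :> R by rewrite ltr0n.
split.
  apply: le_trans (_ : ln 2 * (trunc_log 2 n).+1%:R <= _); last first.
    by rewrite -[X in _ <= X]mul1r ler_wpM2r.
  rewrite mulr_natr -lnXn // ler_ln ?posrE ?exprn_gt0 //.
  by rewrite -natrX ler_nat ltnW // trunc_log_ltn.
apply: le_trans (_ : 2 * (ln 2 * (trunc_log 2 n)%:R) <= _).
  rewrite mulrA -[X in X <= _]mul1r ler_wpM2r //; lra.
rewrite ler_pM2l // mulr_natr -lnXn // ler_ln ?posrE ?exprn_gt0 //.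
by rewrite -natrX ler_nat trunc_logP.
Qed.

Lemma large_n : exists n0 : nat, forall n : nat, (n0 <= n)%N ->
  let L : R := ln n%:R in let D : R := ((trunc_log 2 n).+1 ^ 4)%N%:R in
  exists l h : R, [/\ l ^+ 2 = L, h ^+ 2 = l, 1 <= h & (83 <= n)%N] /\
    [/\ (100 * L) ^+ 2 <= n%:R, 12 * D ^+ 3 <= expR h,
        16 * L * D ^+ 3 <= n%:R & 2 * D ^+ 2 <= n%:R].
Proof.
(* With [h] the fourth root of [L], [D <= (3 * L) ^ 4 = 81 * h ^ 16], so the largest term
   [L * D ^ 3] has degree [4 + 48 = 52] in [h]. *)
have [h0 h0_1 dom] := @expR_dominates R (10 ^+ 8) 52.
have h0_0 : 0 <= h0 := le_trans ler01 h0_1.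
exists (maxn 83 (Num.bound (expR (h0 ^+ 4)))) => n; rewrite geq_max => /andP[n83 nb] L D.
have npos : 0 < n%:R :> R by rewrite ltr0n (leq_trans _ n83).
have leL : h0 ^+ 4 <= L.
  rewrite -ler_expR /L lnK ?posrE //; apply: le_trans (ltW (archi_boundP (expR_ge0 _))) _.
  by rewrite ler_nat.
have L0 : 0 <= L by apply: le_trans leL; rewrite exprn_ge0.
pose h := L `^ 4%:R^-1.
have h4 : h ^+ 4 = L by rewrite powR_nat_root.
have hh0 : h0 <= h by rewrite -(@ler_pXn2r _ 4) ?nnegrE ?powR_ge0 // h4.
have h1 : 1 <= h := le_trans h0_1 hh0.
have h_0 : 0 <= h := le_trans ler01 h1.
have L1 : 1 <= L by rewrite -h4 exprn_ege1.
exists (h ^+ 2), h; split; first by rewrite -exprM h4.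
have hn : expR h <= n%:R.
  rewrite -[X in _ <= X]lnK ?posrE // ler_expR -/L -h4 exprS ler_peMr //.
  by rewrite exprn_ege1.
have dom1 := dom h hh0.
have mono k : (k <= 52)%N -> h ^+ k <= h ^+ 52 by move=> le; apply: ler_weXn2l.
have D_le : D <= 81 * h ^+ 16.
  rewrite /D natrX (_ : 81 * h ^+ 16 = (3 * h ^+ 4) ^+ 4); last by ring.
  apply: lerXn2r; rewrite ?nnegrE // ?mulr_ge0 ?exprn_ge0 //.
  have [_] := log_bounds (leq_trans (isT : (0 < 83)%N) n83).
  by rewrite -natr1 h4 -/L; lra.
have D0 : 0 <= D by [].
pose c : R := 10 ^+ 6.
have c1 : 1 <= c by rewrite exprn_ege1 // ler1n.
have cE : 10 ^+ 8 = 100 * c by rewrite /c; ring.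
have D_le' : D <= 10 ^+ 2 * h ^+ 16.
  apply: le_trans D_le _; apply: ler_wpM2r; first by rewrite exprn_ge0.
  by rewrite expr2; lra.
have D2 : D ^+ 2 <= c * h ^+ 32.
  apply: le_trans (_ : (10 ^+ 2 * h ^+ 16) ^+ 2 <= _).
    by apply: lerXn2r; rewrite ?nnegrE // ?mulr_ge0 ?exprn_ge0.
  rewrite exprMn -!exprM; apply: ler_wpM2r; first by rewrite exprn_ge0.
  by rewrite /c; apply: ler_weXn2l => //; rewrite ler1n.
have D3 : D ^+ 3 <= c * h ^+ 48.
  apply: le_trans (_ : (10 ^+ 2 * h ^+ 16) ^+ 3 <= _).
    by apply: lerXn2r; rewrite ?nnegrE // ?mulr_ge0 ?exprn_ge0.
  by rewrite exprMn -!exprM.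
have h52 : 0 <= h ^+ 52 by rewrite exprn_ge0.
have ch k : (k <= 52)%N -> c * h ^+ k <= c * h ^+ 52.
  by move=> le; apply: ler_wpM2l; [exact: le_trans c1 | apply: mono].
have c32 := ch 32 isT; have c48 := ch 48 isT; have c8 := ch 8 isT.
have ch8 : h ^+ 8 <= c * h ^+ 52.
  by apply: le_trans c8; rewrite ler_peMl ?exprn_ge0.
have ch0 : 0 <= c * h ^+ 52 by rewrite mulr_ge0 //; apply: le_trans c1.
rewrite cE -mulrA in dom1.
split.
- apply: le_trans hn; apply: le_trans dom1.
  have -> : (100 * L) ^+ 2 = 100 * (100 * h ^+ 8) by rewrite -h4; ring.
  rewrite ler_pM2l //; apply: le_trans (_ : c * h ^+ 8 <= _) => //.
  apply: ler_wpM2r; first by rewrite exprn_ge0.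
  by rewrite /c (exprD 10 2 4) -[X in X <= _]mulr1 ler_pM // ?exprn_ege1 ?ler1n // expr2; lra.
- apply: le_trans dom1; lra.
- apply: le_trans hn; apply: le_trans dom1.
  have -> : c * h ^+ 52 = L * (c * h ^+ 48) by rewrite -h4; ring.
  have : L * D ^+ 3 <= L * (c * h ^+ 48) by rewrite ler_wpM2l.
  have : 0 <= L * (c * h ^+ 48) by rewrite !mulr_ge0 ?exprn_ge0 //; apply: le_trans c1.
  rewrite -mulrA; set x := L * D ^+ 3; set y := L * _; lra.
- apply: le_trans hn; apply: le_trans dom1; lra.
Qed.

End Asymptotics.

(** * Existence of the algorithms *)

Section Existence.
Variable R : realType.
Local Open Scope ring_scope.

(** The maximum with 1 matters for edgeless graphs, which still need one color. *)
Definition color_budget n (G : sgraph n) : R :=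
  Num.max 1 ((degeneracy G)%:R + 89 * (degeneracy G)%:R `^ (3 / 4) * ln n%:R `^ (1 / 2)).

Lemma color_budget_ge1 n (G : sgraph n) : 1 <= color_budget G.
Proof. by rewrite le_max lexx. Qed.

Definition output m (w : world m.+1 (trunc_log 2 m)) : 'I_m.+1 -> nat :=
  color 34 (better 34 m.+2 ((trunc_log 2 m.+1).+1 ^ 4) w) w.

Lemma output_whp : exists n0 : nat, forall m (G : sgraph m.+1), (n0 <= m.+1)%N ->
  1 - m.+1%:R^-1 <= prob R (fun s : seeds m.+1 (trunc_log 2 m) =>
    proper_coloring G (Num.truncn (color_budget G)) (output (G, s))).
Proof.
have [n0 big] := large_n R; exists (maxn 2 n0) => m G; rewrite geq_max => /andP[n2 /big].
set n := m.+1; set L := ln _; set D := (_ ^ 4)%N; set kappa := degeneracy G.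
move=> [l [h [[lE hE h1 n83] [big1 big2 big3 big4]]]].
have budget0 : 0 <= color_budget G := le_trans ler01 (color_budget_ge1 G).
have m0 : (0 < m)%N by [].
have leQ : (2 ^ trunc_log 2 m <= m)%N by rewrite trunc_logP.
have gtQ : (m < 2 ^ (trunc_log 2 m).+1)%N by rewrite trunc_log_ltn.
(* It suffices that one of the two variants stays within the budget, as the output uses the better
   one. *)
have fits B (d : nat) : B%:R <= color_budget G -> d = m.+2 \/ d = D ->
    prob R (fun s : seeds n (trunc_log 2 m) => ~~ colors_within G d B s) <= n%:R^-1 ->
    1 - n%:R^-1 <= prob R (fun s : seeds n (trunc_log 2 m) =>
      proper_coloring G (Num.truncn (color_budget G)) (output (G, s))).
  move=> leB dD pB.
  apply: le_trans (@prob_compl R _ (card_seeds_gt0 _ _)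
    (fun s : seeds n (trunc_log 2 m) => ~~ colors_within G d B s) _ _).
    by rewrite lerD2l lerN2.
  move=> s; rewrite negbK => wi; apply: (@better_proper _ _ _ _ _ _ B).
    by case: dD wi => -> ->; rewrite ?orbT.
  by rewrite truncn_ge_nat.
have [k0|k_gt0] := posnP kappa.
  apply: (fits 1%N m.+2); [exact: color_budget_ge1 | by left |].
  rewrite [X in X <= _](_ : _ = 0) ?invr_ge0 ?ler0n //.
  rewrite /prob (_ : [set s | _] = finset.set0) ?cards0 ?mul0r //.
  by apply/setP => s; rewrite !inE edgeless_colors.
have [sigma sigma_inj outk] := degeneracy_order G; rewrite -/kappa in outk.
pose a : R := kappa%:R `^ 4%:R^-1.
have aE : a ^+ 4 = kappa%:R by rewrite powR_nat_root.
have a_0 : 0 <= a by rewrite powR_ge0.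
have a1 : 1 <= a by rewrite -(@ler_pXn2r _ 4) ?nnegrE // expr1n aE ler1n.
have h_0 : 0 <= h := le_trans ler01 h1.
have l1 : 1 <= l by rewrite -hE exprn_ege1.
have L0 : 0 <= L by rewrite -lE exprn_ge0 // -hE exprn_ge0.
have lpow : L `^ (1 / 2) = l.
  rewrite (@powR_frac _ _ 1 2) // expr1; apply/eqP.
  rewrite -(@eqrXn2 _ 2) ?powR_ge0 // ?(le_trans ler01 l1) //.
  by rewrite powR_nat_root // lE.
have budgetE : kappa%:R + 89 * a ^+ 3 * l <= color_budget G.
  by rewrite /color_budget -/kappa -/n -/L lpow (@powR_frac _ _ 3 4) // le_max lexx orbT.
have kn : (kappa <= n)%N := degeneracy_le G.
have [la|al] := leP l a.
  have [B leB pB] := degeneracy_large (R := R) sigma_inj outk leQ gtQ kn aE lE l1 la n83 big1.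
  by apply: (fits B m.+2 (le_trans leB budgetE) _ pB); left.
have [Llg _] := log_bounds R (ltn0Sn m).
have [B leB pB] := degeneracy_small (R := R) sigma_inj outk leQ gtQ kn aE lE hE h1 a1
  (ltW al) n83 big1 Llg big2 big3 big4.
by apply: (fits B D (le_trans leB budgetE) _ pB); right.
Qed.

(** Covers the finitely many small [n], where [n]-bit messages are affordable: all neighbourhoods
    are broadcast, and every node computes the same coloring with [kappa + 1] colors, without
    coins. *)
Lemma small_alg m : exists A : cc_algorithm m.+2,
  [/\ cc_rounds A = 1%N, cc_bits A = m.+2 &
    forall G, whp_colors 1 A G (color_budget G)].
Proof.
pose n := m.+2.
have leM : (#|{: {set 'I_n}}| <= 2 ^ n)%N.
  by rewrite -cardsT -powersetT card_powerset cardsT card_ord.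
have [|E [rE subE kE]] := @reach_bcast m.+1 0 n _ _ _ (fun w v => nbhd w.1 v) (reach0 _ _ _) leM.
  by move=> w w' v [].
pose out (w : world n 0) v : nat :=
  if pcol 0 [set: 'I_n] (nbhd w.1) v is Some x then x else 0%N.
have kout : knows E out.
  move=> w w' v Ew; have e : nbhd w.1 = nbhd w'.1.
    by apply/funext => u; exact: (kE _ _ _ Ew u).
  by rewrite /out e.
have [A [rA bA pA]] := reach_realize rE kout.
exists A; split=> // G; exists (degeneracy G).+1; split.
  rewrite /color_budget le_max; have [->|k0] := posnP (degeneracy G).
    by rewrite lexx.
  apply/orP; right; rewrite -natr1 lerD2l.
  have /andP[l2 _] := ln2_bounds R.
  have L2 : 2^-1 <= ln m.+2%:R :> R.
    by apply: le_trans l2 _; rewrite ler_ln ?posrE // ler_nat.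
  have L0 : 0 <= ln m.+2%:R :> R by apply: le_trans L2; rewrite invr_ge0.
  have p1 : 1 <= (degeneracy G)%:R `^ (3 / 4) :> R.
    rewrite (@powR_frac _ _ 3 4) // exprn_ege1 // -(@ler_pXn2r _ 4) ?nnegrE ?powR_ge0 //.
    by rewrite expr1n powR_nat_root // ler1n.
  have p2 : 2^-1 <= ln m.+2%:R `^ (1 / 2) :> R.
    rewrite (@powR_frac _ _ 1 2) // expr1 -(@ler_pXn2r _ 2) ?nnegrE ?powR_ge0 ?invr_ge0 //.
    rewrite powR_nat_root //; apply: le_trans L2; rewrite expr2; lra.
  apply: le_trans (_ : 89 * 1 * 2^-1 <= _); first by lra.
  by apply: ler_pM => //; rewrite ?invr_ge0 ?mulr_ge0 // ler_pM2l.
rewrite pA [X in _ <= X](_ : _ = 1).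
  by rewrite gerBl invr_ge0 exprn_ge0.
rewrite /prob (_ : [set s | _] = [set: seeds n 0]).
  by rewrite cardsT mulfV // pnatr_eq0 -lt0n card_seeds_gt0.
apply/setP => s; rewrite !inE; apply/idP.
have [sigma sigma_inj outk] := degeneracy_order G.
have lek : (ncol 0 [set: 'I_n] (nbhd G) <= (degeneracy G).+1)%N.
  by apply: (ncol_kappa sigma_inj outk) => v u _; rewrite inE.
have some v : exists x, pcol 0 [set: 'I_n] (nbhd G) v = Some x.
  case e: (pcol 0 [set: 'I_n] (nbhd G) v) => [x|]; first by exists x.
  have := pcol_card 0 [set: 'I_n] (nbhd G).
  by rewrite leqn0 => /eqP/cards0_eq/setP/(_ v); rewrite !inE e.
apply: proper_coloring_mono lek _; apply/andP; split.
  apply/forallP => v; rewrite /out /=; have [x e] := some v; rewrite e.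
  by apply: pcol_lt e; rewrite inE.
apply/forallP => u; apply/forallP => v; apply/implyP => Guv; rewrite /out /=.
have [x ex] := some u; have [y ey] := some v; rewrite ex ey.
apply: pcol_neq ex ey; rewrite ?inE // ?[G v u]adj_sym //.
by apply: contraTneq Guv => ->; rewrite adj_irr.
Qed.

Lemma large_alg m : (2 <= m.+1)%N -> exists A : cc_algorithm m.+1,
  [/\ cc_rounds A = 24, cc_bits A = (36 * (trunc_log 2 m.+1).+1)%N &
    forall G k, cc_prob R (fun s : cc_seed A => proper_coloring G k (cc_output G s)) =
      prob R (fun s : seeds m.+1 (trunc_log 2 m) => proper_coloring G k (output (G, s)))].
Proof.
move=> n2; pose b := (36 * (trunc_log 2 m.+1).+1)%N.
have ltn : (m.+2 <= 2 ^ (trunc_log 2 m.+1).+1)%N by rewrite trunc_log_ltn.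
have bE k : (k <= 36)%N -> (m.+2 ^ k <= 2 ^ b)%N.
  move=> lek; apply: leq_trans (leq_expn2r k ltn) _.
  by rewrite -expnM leq_exp2l // mulnC leq_mul2r lek orbT.
have leb2 : (m.+2 * m.+2 <= 2 ^ b)%N by rewrite mulnn bE.
have lebK : (m.+1 ^ 34 <= 2 ^ b)%N.
  exact: leq_trans (leq_expn2r 34 (leqnSn _)) (bE 34 isT).
have leQ : (2 ^ trunc_log 2 m <= m.+1)%N by apply: leqW; rewrite trunc_logP.
have [E rE kE] := reach_better leb2 lebK m.+2 ((trunc_log 2 m.+1).+1 ^ 4) leQ.
have [A [rA bA pA]] := reach_realize rE kE.
by exists A; split=> // G k; rewrite pA.
Qed.

Definition silent_alg n : cc_algorithm n :=
  @CCAlgorithm n 0 0 0 unit (fun _ _ _ => tt) (fun _ _ _ _ => [bseq])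
    (fun _ _ _ _ => tt) (fun _ _ => 0%N).

Lemma exists_alg : exists B : R, forall n, exists A : cc_algorithm n,
  ((0 < n)%N -> (cc_rounds A <= 24)%N /\ (cc_bits A)%:R <= B * ln n%:R) /\
  (forall G, (0 < n)%N -> whp_colors 1 A G (color_budget G)).
Proof.
have [n0 whp] := output_whp.
(* Since [ln n >= 1/2] for [n >= 2], [n < n0] gives [n <= 2 * n0 * ln n], and the large algorithm
   uses [36 * (trunc_log 2 n + 1) <= 36 * (2 + 2) * ln n] bits. *)
exists (2 * n0%:R + 144) => -[|[|m]].
- by exists (silent_alg 0).
- exists (silent_alg 1); split=> [_|G _]; first by rewrite /= ln1 mulr0.
  (* For [n = 1] the required probability [1 - 1 / n] is 0, and [ln 1 = 0] forces silence. *)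
  exists 1%N; split; first exact: color_budget_ge1.
  by rewrite expr1 invr1 subrr divr_ge0 ?ler0n.
have /andP[l2 _] := ln2_bounds R.
have L2 : 2^-1 <= ln m.+2%:R :> R.
  by apply: le_trans l2 _; rewrite ler_ln ?posrE // ler_nat.
have L0 : 0 <= ln m.+2%:R :> R by apply: le_trans L2; rewrite invr_ge0.
have n00 : 0 <= n0%:R :> R by [].
have [lt|le] := ltnP m.+2 n0.
  have [A [rA bA whpA]] := small_alg m; exists A; split=> [_|G _]; last exact: whpA.
  rewrite rA bA; split=> //.
  have ltR : m.+2%:R <= n0%:R :> R by rewrite ler_nat ltnW.
  have : n0%:R * 2^-1 <= n0%:R * ln m.+2%:R :> R by rewrite ler_wpM2l.
  by move: L0 L2 ltR; set L := ln _; set N := n0%:R; set x := m.+2%:R; nra.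
have [A [rA bA pA]] := @large_alg m.+1 isT; exists A; split=> [_|G _].
  rewrite rA bA; split=> //.
  have [_ lg] := log_bounds R (ltn0Sn m.+1).
  have nL : 0 <= n0%:R * ln m.+2%:R :> R by rewrite mulr_ge0.
  rewrite natrM -natr1.
  by move: lg L2 nL; set L := ln _; set x := (trunc_log _ _)%:R; set N := n0%:R; nra.
exists (Num.truncn (color_budget G)); split.
  by rewrite truncn_le (le_trans ler01) // color_budget_ge1.
by rewrite pA expr1; apply: whp.
Qed.

End Existence.

(** * The limit statement *)

Local Open Scope classical_set_scope.
Local Open Scope ring_scope.

Lemma budget_littleo (R : realType) (C : R) (L k : nat -> R) :
  0 < C -> (forall i, 0 <= L i) -> (forall i, 0 <= k i) ->
  (fun i => L i ^+ 2 : R^o) =o_\oo (k : nat -> R^o) ->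
  (fun i => C * k i `^ (3 / 4) * L i `^ (1 / 2) : R^o) =o_\oo (k : nat -> R^o).
Proof.
move=> C0 L0 k0 /eqoP Lo; apply/eqoP => e e0.
(* With this constant the hypothesis reads [l ^ 4 <= (e / C * a) ^ 4], so
   [C * a ^ 3 * l <= e * a ^ 4]. *)
have eC : 0 < (e / C) ^+ 4 by rewrite exprn_gt0 // divr_gt0.
have := Lo _ eC; apply: filterS => i.
rewrite !ger0_norm ?exprn_ge0 ?mulr_ge0 ?powR_ge0 ?(ltW C0) //.
rewrite (@powR_frac _ _ 3 4) // (@powR_frac _ _ 1 2) // expr1.
set a := k i `^ _; set l := L i `^ _.
have aE : a ^+ 4 = k i by rewrite powR_nat_root.
have lE : l ^+ 2 = L i by rewrite powR_nat_root.
have a0 : 0 <= a by rewrite powR_ge0.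
have l0 : 0 <= l by rewrite powR_ge0.
rewrite -aE -lE -exprM -exprMn => le.
have {}le : l <= e / C * a.
  have eC0 : 0 <= e / C by rewrite ltW // divr_gt0.
  by rewrite -(@ler_pXn2r _ 4) ?nnegrE // mulr_ge0.
have -> : e * a ^+ 4 = C * a ^+ 3 * (e / C * a) by field; rewrite lt0r_neq0.
by apply: ler_wpM2l => //; rewrite mulr_ge0 ?exprn_ge0 // ltW.
Qed.

Theorem theorem4p4 (R : realType) :
  exists (A : forall n : nat, cc_algorithm n) (T : nat) (B C : R) (c : nat),
    [/\ (0 < c)%N,
        forall n : nat, (0 < n)%N ->
          (cc_rounds (A n) <= T)%N /\ (cc_bits (A n))%:R <= B * ln (n%:R : R),
        forall (n : nat) (G : sgraph n), (0 < n)%N ->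
          whp_colors c (A n) G
            (Num.max 1 ((degeneracy G)%:R
               + C * (degeneracy G)%:R `^ (3 / 4) * ln n%:R `^ (1 / 2))) &
        forall (N : nat -> nat) (G : forall i : nat, sgraph (N i)),
          N @ \oo --> \oo ->
          (fun i : nat => ln (N i)%:R ^+ 2 : R^o)
            =o_\oo (fun i : nat => (degeneracy (G i))%:R : R^o) ->
          exists2 g : nat -> R^o,
            g =o_\oo (fun i : nat => (degeneracy (G i))%:R : R^o) &
            \forall i \near \oo,
              whp_colors c (A (N i)) (G i) ((degeneracy (G i))%:R + g i)].
Proof.
have [B HB] := exists_alg R.
pose A n := projT1 (cid (HB n)); have AP n := projT2 (cid (HB n)).
exists A, 24%N, B, 89, 1%N; split=> //.
- by move=> n; apply: (AP n).1.
- by move=> n G n0; apply: (AP n).2.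
move=> N G Noo Lo.
have ln0 i : 0 <= ln (N i)%:R :> R.
  by case: (N i) => [|k]; [rewrite ln0 | rewrite ln_ge0 // ler1n].
exists (fun i => 89 * (degeneracy (G i))%:R `^ (3 / 4) * ln (N i)%:R `^ (1 / 2)).
  exact: budget_littleo.
have N2 : \forall i \near \oo, (2 <= N i)%N := Noo _ (nbhs_infty_ge 2).
have /eqoP/(_ 1 ltr01) L1 := Lo.
near=> i.
have Ni : (2 <= N i)%N by near: i.
have lt : 0 < ln (N i)%:R :> R by rewrite ln_gt0 // ltr1n.
(* A positive logarithm dominated by the degeneracy makes the latter positive, so the maximum with 1
   disappears. *)
have kpos : (0 < degeneracy (G i))%N.
  have : `|ln (N i)%:R ^+ 2 : R^o| <= 1 * `|(degeneracy (G i))%:R : R^o| by near: i.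
  rewrite lt0n; apply: contraTneq => ->; rewrite normr0 mulr0 -ltNge normr_gt0.
  by rewrite expf_neq0 // lt0r_neq0.
suff <- : color_budget R (G i) = (degeneracy (G i))%:R +
    89 * (degeneracy (G i))%:R `^ (3 / 4) * ln (N i)%:R `^ (1 / 2).
  exact: (AP (N i)).2 (G i) (ltnW Ni).
apply/max_idPr; apply: (@le_trans _ _ (degeneracy (G i))%:R); first by rewrite ler1n.
by rewrite lerDl !mulr_ge0 ?powR_ge0.
Unshelve. all: by end_near.
Qed.
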